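(* Let $V$ be a unital JB-algebra and let $x\in V$ be invertible. The isotope $V_x$ is Jordan isomorphic to $V$ if and only if $U_x$ is a positive operator, i.e. $\sigma(U_x)\subset(0,+\infty)$.
   Context: A (unital) JB-algebra is a real Jordan algebra $(V,\circ)$ with unit $1$ (the product is bilinear, commutative and $x^2\circ(x\circ y)=x\circ(x^2\circ y)$) with a complete norm such that $\|x\circ y\|\le\|x\|\|y\|$, $\|x^2\|=\|x\|^2$, $\|x^2\|\le\|x^2+y^2\|$; it may be infinite dimensional. $B(V)$ is the algebra of bounded linear operators on $V$; for $T\in B(V)$, $\sigma(T)=\{t\in\mathbb R: T-t\,\mathrm{Id}\text{ is not invertible in }B(V)\}$. $L_xy=x\circ y$, $U_x=2L_x^2-L_{x^2}$, $U_{x,y}=\frac12(U_{x+y}-U_x-U_y)$. An element $x$ is invertible if $U_x$ is an invertible operator. For $x\in V$ invertible, the isotope $V_x$ is the vector space $V$ with product $a\cdot_xb=U_{a,b}(x)$; it is a unital Jordan algebra with unit $x^{-1}$. A Jordan isomorphism is a linear bijection preserving the Jordan products. *)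

(* Defs.v *)
From HB Require Import structures.
From mathcomp Require Import all_boot all_order all_algebra.
From mathcomp Require Import boolp classical_sets reals topology normedtype sequences.

Set Implicit Arguments.
Unset Strict Implicit.
Unset Printing Implicit Defensive.

Import Order.TTheory GRing.Theory Num.Theory.
Import numFieldNormedType.Exports.

Local Open Scope classical_set_scope.
Local Open Scope ring_scope.

(* Bilinearity on the left only: the right-hand laws follow from [jmulC]. *)
HB.mixin Record Lmodule_isJordanAlgebra (R : nzRingType) V
    of GRing.Lmodule R V := {
  jmul : V -> V -> V;
  jone : V;
  jmulC : commutative jmul;
  jmulDl : left_distributive jmul +%R;
  jmulZl : forall (a : R) (x y : V), jmul (a *: x) y = a *: jmul x y;
  jmul1 : left_id jone jmul;
  jordan_identity : forall x y : V,
    jmul (jmul x x) (jmul x y) = jmul x (jmul (jmul x x) y)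
}.

#[short(type="jordanAlgType")]
HB.structure Definition JordanAlgebra (R : nzRingType) :=
  {V of Lmodule_isJordanAlgebra R V & GRing.Lmodule R V}.

HB.mixin Record JordanAlgebra_isJB (R : realType) V
    of JordanAlgebra R V & CompleteNormedModule R V := {
  jb_normM : forall x y : V, `|jmul x y| <= `|x| * `|y|;
  jb_norm_sqr : forall x : V, `|jmul x x| = `|x| ^+ 2;
  jb_norm_sqrD : forall x y : V, `|jmul x x| <= `|jmul x x + jmul y y|
}.

#[short(type="jbAlgType")]
HB.structure Definition JBAlgebra (R : realType) :=
  {V of JordanAlgebra_isJB R V & JordanAlgebra R V & CompleteNormedModule R V}.

Section Operators.
Context {R : realType} {V : normedModType R}.
Implicit Types T S : V -> V.

Definition bounded_operator T : Prop := linear T /\ bounded_fun_norm T.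

(* Invertibility in the algebra B(V): the inverse must be bounded as well. *)
Definition invertible_operator T : Prop :=
  bounded_operator T /\
  exists S, [/\ bounded_operator S, cancel T S & cancel S T].

(* The real spectrum; it is not the spectrum of the complexification. *)
Definition spectrum T : set R :=
  [set t | ~ invertible_operator (fun y => T y - t *: y)].

Definition positive_operator T : Prop := spectrum T `<=` [set t | 0 < t].

End Operators.

Section Jordan.
Context {R : realType} {V : jordanAlgType R}.
Implicit Types x y a b : V.

Definition Lop x : V -> V := fun y => jmul x y.

Definition Uop x : V -> V := fun y =>
  2 *: Lop x (Lop x y) - Lop (jmul x x) y.

Definition Uop2 x y : V -> V := fun z =>
  2^-1 *: (Uop (x + y) z - Uop x z - Uop y z).

(* The product of the isotope V_x, whose underlying vector space is V. *)
Definition isotope_mul x a b : V := Uop2 a b x.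

End Jordan.

Definition invertible {R : realType} {V : jbAlgType R} (x : V) : Prop :=
  invertible_operator (Uop x).

(* The products are explicit arguments because V and its isotopes share one
   carrier. No continuity is required of the isomorphism. *)
Definition jordan_isomorphic {R : realType} {V W : lmodType R}
    (mulV : V -> V -> V) (mulW : W -> W -> W) : Prop :=
  exists f : V -> W,
    [/\ linear f, bijective f & forall a b, f (mulV a b) = mulW (f a) (f b)].

(* Main.v *)
(* Let [p = |x|], [w = p^(1/2)] and let [s] be the sign of [x], all taken in the
   closed associative subalgebra generated by [x], so that [s^2 = 1] and
   [x = U_w s]. Both sides of the equivalence turn out to mean that [L_s] is
   injective.
   If it is, [s] is central, [U_x = U_p] has positive spectrum by a Cayley
   transform, and [a |-> s (U_w a)] is an isomorphism from [V_x] onto [V]. If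
   [s y = 0] with [y <> 0], then [U_y s = - U_|y| s], so in the isotope two
   nonzero squares add up to 0, which cannot happen in [V]; moreover on
   [ker L_s] the operator [- U_x] is a product of squares of two commuting
   operators with a joint approximate eigenvector, so [U_x] has a nonpositive
   real spectral value. *)
From HB Require Import structures.
Require Import Defs.
From mathcomp Require Import all_boot all_order all_algebra.
From mathcomp Require Import boolp classical_sets functions reals topology.
From mathcomp Require Import normedtype sequences.
From mathcomp Require Import ring lra.
Set Implicit Arguments.
Unset Strict Implicit.
Unset Printing Implicit Defensive.
Import Order.TTheory GRing.Theory Num.Theory.
Import numFieldNormedType.Exports.
Local Open Scope classical_set_scope.
Local Open Scope ring_scope.

(** All positivity is drawn from the norm axioms: a positive element is encoded as a square, and
    [|a^2| <= |a^2 + b^2|] replaces monotonicity of the norm. In infinite dimension [ker L_s] need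
    not contain an eigenvector of [U_x], and only real spectral values count, so approximate
    eigenvectors are built by hand. With [e = (1 + s)/2] and [f = (1 - s)/2], [ker L_s] is the
    Peirce half space of both idempotents, and the two commuting operators of the overview are the
    multiplications by [2 w e] and [2 w f]; they enter because [x = w^2 (e - f)]. The approximate
    values found depend on the precision, so they contradict positivity only against a lower bound
    for [U_x + t] that is uniform over a compact range of [t]. *)

Inductive lexp (K : Type) :=
  LZero | LVar of nat | LAdd of lexp K & lexp K | LOpp of lexp K
| LScale of K & lexp K.
Arguments LZero {K}.
Arguments LVar {K}.

(** * Linear identities in a module, checked coefficient by coefficient *)

Section LinearExpressions.
Context {R : realType} {V : lmodType R}.

Fixpoint leval (env : seq V) (e : lexp R) : V :=
  match e with
  | LZero => 0
  | LVar i => nth 0 env i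
  | LAdd a b => leval env a + leval env b
  | LOpp a => - leval env a
  | LScale k a => k *: leval env a
  end.

Fixpoint lcoef (e : lexp R) (i : nat) : R :=
  match e with
  | LZero => 0
  | LVar j => if Nat.eqb i j then 1 else 0
  | LAdd a b => lcoef a i + lcoef b i
  | LOpp a => - lcoef a i
  | LScale k a => k * lcoef a i
  end.

Lemma leval_sum env e :
  leval env e = \sum_(i < size env) lcoef e i *: nth 0 env i.
Proof.
elim: e => [|j|a IHa b IHb|a IHa|k a IHa] /=.
- by rewrite big1 // => i _; rewrite scale0r.
- have eqbE i k : Nat.eqb i k = (i == k) by apply/idP/eqP => /PeanoNat.Nat.eqb_eq.
  have [jlt|jge] := ltnP j (size env).
    rewrite (bigD1 (Ordinal jlt)) //= eqbE eqxx scale1r big1 ?addr0 // => i.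
    by rewrite -val_eqE /= eqbE => /negbTE ->; rewrite scale0r.
  rewrite nth_default // big1 // => i _; rewrite eqbE ltn_eqF ?scale0r //.
  exact: leq_trans (ltn_ord i) jge.
- by rewrite IHa IHb -big_split; apply: eq_bigr => i _; rewrite scalerDl.
- by rewrite IHa -sumrN; apply: eq_bigr => i _; rewrite scaleNr.
- by rewrite IHa scaler_sumr; apply: eq_bigr => i _; rewrite scalerA.
Qed.

(** A nested conjunction instead of a quantifier, so that [cbn] turns it into separate scalar
    goals. *)
Fixpoint lcoef_eq (n : nat) (a b : lexp R) : Prop :=
  if n is m.+1 then lcoef a m = lcoef b m /\ lcoef_eq m a b else True.

Lemma leval_eq env a b : lcoef_eq (size env) a b -> leval env a = leval env b.
Proof.
rewrite !leval_sum => h; apply: eq_bigr => -[i /= ilt] _; congr (_ *: _).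
by elim: (size env) h ilt => //= m IHm [hm /IHm h]; rewrite ltnS leq_eqVlt => /predU1P[->|].
Qed.

End LinearExpressions.

Ltac lin_mem x env :=
  lazymatch env with
  | nil => constr:(false)
  | x :: _ => constr:(true)
  | _ :: ?t => lin_mem x t
  end.
Ltac lin_index x env :=
  lazymatch env with
  | x :: _ => constr:(0%N)
  | _ :: ?t => let i := lin_index x t in constr:(i.+1)
  end.
Ltac lin_atoms e env :=
  lazymatch e with
  | 0%R => env
  | (?a + ?b)%R => let env := lin_atoms a env in lin_atoms b env
  | (- ?a)%R => lin_atoms a env
  | (_ *: ?a)%R => lin_atoms a env
  | ?a => let m := lin_mem a env in
      lazymatch m with true => env | false => constr:(a :: env) end
  end.
Ltac lin_quote R e env :=
  lazymatch e with
  | 0%R => constr:(@LZero R)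
  | (?a + ?b)%R => let a := lin_quote R a env in let b := lin_quote R b env in
      constr:(@LAdd R a b)
  | (- ?a)%R => let a := lin_quote R a env in constr:(@LOpp R a)
  | (?k *: ?a)%R => let a := lin_quote R a env in constr:(@LScale R k a)
  | ?a => let i := lin_index a env in constr:(@LVar R i)
  end.

(* Equality of linear combinations in a module, reduced to one scalar goal per
   atom. *)
Ltac lin_eq :=
  lazymatch goal with
  | R : realType |- ?x = ?y :> ?V =>
    let R := constr:(Real.sort R) in
    let env := lin_atoms x (@nil V) in
    let env := lin_atoms y env in
    let ex := lin_quote R x env in
    let ey := lin_quote R y env in
    apply: (@leval_eq _ _ env ex ey);
    cbn [lcoef_eq size lcoef Nat.eqb];
    repeat split; first [ring | by field | idtac]
  end.

(** * Jordan identities and the fundamental formula *)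

Section JordanIdentities.
Context {R : realType} {V : jordanAlgType R}.
Local Notation "x ** y" := (@jmul R V x y) (at level 40, left associativity).
Implicit Types a b c s u v w x y z : V.

(* [jmulC] with its ring argument in the form that [@jmul R V] elaborates to, so
   that commuted products stay syntactically equal. *)
Lemma jmulxC x y : x ** y = y ** x.
Proof. exact: jmulC. Qed.

Lemma jmulDr x y z : x ** (y + z) = x ** y + x ** z.
Proof. by rewrite jmulxC jmulDl !(jmulxC x). Qed.

Lemma jmulZr k x y : x ** (k *: y) = k *: (x ** y).
Proof. by rewrite jmulxC jmulZl (jmulxC x). Qed.

Lemma jmulNl x y : (- x) ** y = - (x ** y).
Proof. by rewrite -scaleN1r jmulZl scaleN1r. Qed.

Lemma jmulNr x y : x ** (- y) = - (x ** y).
Proof. by rewrite !(jmulxC x) jmulNl. Qed.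

Lemma jmulBl x y z : (x - y) ** z = x ** z - y ** z.
Proof. by rewrite jmulDl jmulNl. Qed.

Lemma jmulBr x y z : x ** (y - z) = x ** y - x ** z.
Proof. by rewrite jmulDr jmulNr. Qed.

Lemma jmul0 x : 0 ** x = 0.
Proof. by rewrite -(scale0r x) jmulZl !scale0r. Qed.

Lemma jmulr0 x : x ** 0 = 0.
Proof. by rewrite jmulxC jmul0. Qed.

Lemma jmulr1 x : x ** jone = x.
Proof. by rewrite jmulxC jmul1. Qed.

Definition jmulE := (jmulBl, jmulBr, @jmulDl R V, jmulDr, jmulNl, jmulNr,
  @jmulZl R V, jmulZr, jmul0, jmulr0, @jmul1 R V, jmulr1).

(** Certificate form: [x' = y'] is a combination of known identities, and the last hypothesis is a
    formal linear identity left to [lin_eq]. *)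
Lemma lin_combine (k : R) x y x' y' :
  x' = y' -> k != 0 -> k *: (x - y) = x' - y' -> x = y.
Proof.
move=> -> k0; rewrite subrr => /eqP; rewrite scaler_eq0 (negPf k0).
by move=> /=; rewrite subr_eq0 => /eqP.
Qed.

Arguments lin_combine k {x y x' y'}.

(** Polarization: the part of the Jordan identity at [x + y] that is odd in [y], minus the cubic
    term in [y]. *)
Lemma jordan_linearized2 x y w :
  (x ** x) ** (y ** w) + 2 *: ((x ** y) ** (x ** w)) =
  y ** ((x ** x) ** w) + 2 *: (x ** ((x ** y) ** w)).
Proof.
have h := congr2 (fun a b => a - b) (jordan_identity (x + y) w)
  (jordan_identity (x - y) w).
apply: (lin_combine 2 (congr2 (fun a b => a - 2 *: b) h (jordan_identity y w))).
  by rewrite pnatr_eq0.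
rewrite !jmulE !(jmulxC y x).
lin_eq.
Qed.

Lemma jordan_linearized x y z w :
  (x ** y) ** (z ** w) + (y ** z) ** (x ** w) + (z ** x) ** (y ** w) =
  z ** ((x ** y) ** w) + x ** ((y ** z) ** w) + y ** ((z ** x) ** w).
Proof.
have h := congr2 (fun a b => a - b) (jordan_linearized2 (x + z) y w)
  (jordan_linearized2 x y w).
apply: (lin_combine 2 (congr2 (fun a b => a - b) h (jordan_linearized2 z y w))).
  by rewrite pnatr_eq0.
rewrite !jmulE !(jmulxC z x) !(jmulxC y z).
lin_eq.
Qed.

(** The left side of [jordan_linearized] is symmetric in [z] and [w], so its right side is too. *)
Lemma Lop_mul3 x y z w :
  ((x ** y) ** z) ** w =
  z ** ((x ** y) ** w) + x ** ((y ** z) ** w) + y ** ((z ** x) ** w)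
  - x ** (z ** (y ** w)) - y ** (z ** (x ** w)).
Proof.
rewrite -(jordan_linearized x y z w).
rewrite (jmulxC z w) (jmulxC y w) (jmulxC x w) (jmulxC (y ** z)) (jmulxC (z ** x)).
rewrite (jmulxC z (w ** y)) (jmulxC z (w ** x)) (jmulxC _ w).
have := jordan_linearized x y w z.
rewrite (jmulxC y w) (jmulxC z x) (jmulxC (w ** y)) (jmulxC y z) (jmulxC x z).
move=> h; apply: (lin_combine 1 (esym h) (oner_neq0 _)).
lin_eq.
Qed.
(** [[L_x, L_y]] is a derivation: subtract the expansions of [L_((zy)x)] and [L_((zx)y)]. *)
Lemma Lop_commutator_der x y z w :
  x ** (y ** (z ** w)) - y ** (x ** (z ** w)) =
  (x ** (y ** z) - y ** (x ** z)) ** w + z ** (x ** (y ** w) - y ** (x ** w)).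
Proof.
have h1 := Lop_mul3 z y x w; have h2 := Lop_mul3 z x y w.
rewrite (jmulxC x (y ** z)) (jmulxC y (x ** z)) (jmulxC y z) (jmulxC x z).
rewrite !jmulE h1 h2 (jmulxC y x) (jmulxC x z) (jmulxC y z).
lin_eq.
Qed.

(** The Jordan triple product, normalized so that [trip x y x] is [U_x y]. *)
Definition trip u v w := (u ** v) ** w + u ** (v ** w) - v ** (u ** w).

Lemma tripC u v w : trip u v w = trip w v u.
Proof.
rewrite /trip (jmulxC w v) (jmulxC w u) (jmulxC (v ** w)) (jmulxC w (v ** u)).
by rewrite (jmulxC v u) (addrC (u ** _)).
Qed.

Lemma tripDl u u' v w : trip (u + u') v w = trip u v w + trip u' v w.
Proof. rewrite /trip !jmulE; lin_eq. Qed.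
Lemma tripDm u v v' w : trip u (v + v') w = trip u v w + trip u v' w.
Proof. rewrite /trip !jmulE; lin_eq. Qed.
Lemma tripZm k u v w : trip u (k *: v) w = k *: trip u v w.
Proof. rewrite /trip !jmulE; lin_eq. Qed.

Lemma tripDr u v w w' : trip u v (w + w') = trip u v w + trip u v w'.
Proof. by rewrite !(tripC u) tripDl. Qed.

Lemma Lop_trip a u v w :
  a ** trip u v w = trip (a ** u) v w - trip u (a ** v) w + trip u v (a ** w).
Proof.
have h1 := Lop_commutator_der v u a w.
have h2 := jordan_linearized a u v w.
rewrite /trip !jmulE in h1 *.
rewrite (jmulxC (a ** u) (v ** w)) (jmulxC v a) (jmulxC u v) in h1 h2 *.
apply: (lin_combine 1 (congr2 (fun a b => a - b) h1 h2) (oner_neq0 _)).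
rewrite (jmulxC (a ** u) v) (jmulxC a u).
lin_eq.
Qed.

(** [trip x y] is the operator [L_(xy) + [L_x, L_y]]. The first summand obeys the rule with a minus
    sign in the middle slot, the second is a derivation; exchanging [x] and [y] reverses only the
    second. *)
Lemma jordan_triple_identity x y u v w :
  trip x y (trip u v w) =
  trip (trip x y u) v w - trip u (trip y x v) w + trip u v (trip x y w).
Proof.
pose D z := x ** (y ** z) - y ** (x ** z).
have DM a b : D (a ** b) = D a ** b + a ** D b by exact: Lop_commutator_der.
have Dtrip : D (trip u v w) = trip (D u) v w + trip u (D v) w + trip u v (D w).
  have -> : D (trip u v w) = D ((u ** v) ** w) + D (u ** (v ** w)) - D (v ** (u ** w)).
    rewrite /D /trip !jmulE; lin_eq.
  rewrite !DM /trip !jmulDl !jmulDr; lin_eq.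
have E a : trip x y a = (x ** y) ** a + D a by rewrite /D addrA.
have E' a : trip y x a = (x ** y) ** a - D a.
  by rewrite /D /trip (jmulxC y x) opprB addrA.
rewrite !E E' Lop_trip Dtrip !(tripDl, tripDr) tripDm -(scaleN1r (D v)) tripZm.
lin_eq.
Qed.

(** The two instances of the triple identity read [A = 2B - Q] and [B = 2A - Q]; hence
    [A = B = Q]. *)
Lemma trip_outer x y z :
  trip x y (trip x z x) = trip x (trip y x z) x /\
  trip x z (trip x y x) = trip x (trip y x z) x.
Proof.
have h1 := jordan_triple_identity x y x z x.
have h2 := jordan_triple_identity x z x y x.
rewrite (tripC (trip x y x)) in h1; rewrite (tripC (trip x z x)) (tripC z) in h2.
have h : trip x y (trip x z x) = trip x z (trip x y x).
  apply: (lin_combine 3 (congr2 (fun a b => a - b) h1 h2)).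
    by rewrite pnatr_eq0.
  lin_eq.
have h3 : trip x z (trip x y x) = trip x (trip y x z) x.
  apply: (lin_combine 1 (esym h1) (oner_neq0 _)); rewrite h; lin_eq.
by split; rewrite ?h h3.
Qed.

Lemma trip_shift x y z : trip (trip x y x) y z = trip x (trip y x y) z.
Proof.
apply: (lin_combine 1 (esym (jordan_triple_identity x y x y z)) (oner_neq0 _)); lin_eq.
Qed.

Lemma UopE x y : Uop x y = trip x y x.
Proof. by rewrite /Uop /Lop /trip (jmulxC y) (jmulxC y) (jmulxC (x ** y)); lin_eq. Qed.

(** Expanding [trip x y (trip p z x)] gives [trip p z p = U_x (2 (trip y x w) - trip y p z)], and
    [h] identifies the argument of [U_x] as [U_y U_x z]. *)
Lemma fundamental_formula x y z : Uop (Uop x y) z = Uop x (Uop y (Uop x z)).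
Proof.
rewrite !UopE; set p := trip x y x; set w := trip y x z.
have h1 := jordan_triple_identity x y p z x.
have h2 := jordan_triple_identity y x z x y.
have h3 := jordan_triple_identity z x y x y.
have pzx : trip p z x = trip x w x by rewrite tripC (trip_outer x y z).2.
have pwx : trip p w x = trip x (trip y x w) x by rewrite tripC (trip_outer x y w).2.
have xyp : trip x y p = trip x (trip y x y) x by rewrite (trip_outer x y y).1.
have xqx : trip (trip x (trip y x y) x) z x = trip x (trip y p z) x.
  by rewrite tripC (trip_outer x (trip y x y) z).2 trip_shift.
rewrite pzx pwx xyp xqx (trip_outer x y w).1 -/p in h1.
have h : 2 *: trip y x w = trip y p z + trip y (trip x z x) y.
  rewrite (tripC z x y) -/w (tripC w) (tripC z x (trip y x y)) trip_shift -/p in h3.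
  apply: (lin_combine 1 (esym h3) (oner_neq0 _)); lin_eq.
have := congr1 (fun a => trip x a x) h; rewrite /= tripZm tripDm => h4.
apply: (lin_combine 1 (congr2 (fun a b => a + b) h4 (esym h1)) (oner_neq0 _)).
lin_eq.
Qed.

Lemma Uop2E a b z : Uop2 a b z = trip a z b.
Proof.
rewrite /Uop2 !UopE tripDl !tripDr (tripC b z a); lin_eq.
Qed.

Lemma Uop2xx a z : Uop2 a a z = Uop a z.
Proof. by rewrite Uop2E UopE. Qed.

Lemma UopD x y z : Uop x (y + z) = Uop x y + Uop x z.
Proof. by rewrite !UopE tripDm. Qed.

Lemma UopZ k x y : Uop x (k *: y) = k *: Uop x y.
Proof. by rewrite !UopE tripZm. Qed.

Lemma UopB x y z : Uop x (y - z) = Uop x y - Uop x z.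
Proof. by rewrite UopD -scaleN1r UopZ scaleN1r. Qed.

Lemma Uop0 x : Uop x 0 = 0.
Proof. by rewrite /Uop /Lop !jmulr0 scaler0 subrr. Qed.

(** Polarized fundamental formula: [U_x] is a homomorphism from the isotope of [U_x z] to the
    isotope of [z]. *)
Lemma Uop_Uop2 x a b z :
  Uop2 (Uop x a) (Uop x b) z = Uop x (Uop2 a b (Uop x z)).
Proof.
by rewrite /Uop2 -(UopD x a b) !fundamental_formula UopZ !UopB.
Qed.

Lemma Uop_jone x : Uop x jone = x ** x.
Proof. by rewrite /Uop /Lop !jmulE; lin_eq. Qed.

Lemma Uop1 y : Uop jone y = y.
Proof. by rewrite /Uop /Lop !jmulE; lin_eq. Qed.

Lemma Uop_sqr x y : Uop (x ** x) y = Uop x (Uop x y).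
Proof. by rewrite -Uop_jone fundamental_formula Uop1. Qed.

(** The terms containing [s^2 = 1] cancel in the linearized identity; what is left says that
    [L_(sa)] commutes with [L_s]. *)
Lemma symmetry_LopC s a w : s ** s = jone -> (s ** a) ** (s ** w) = s ** ((s ** a) ** w).
Proof.
move=> s2; have := jordan_linearized2 s a w; rewrite s2 !jmul1 => h.
apply: (lin_combine 2 h); first by rewrite pnatr_eq0.
lin_eq.
Qed.

Lemma symmetry_Lop3 s w : s ** s = jone -> s ** (s ** (s ** w)) = s ** w.
Proof.
move=> s2; have := Lop_mul3 s s s w; rewrite s2 !jmul1 => h.
apply: (lin_combine 2 h); first by rewrite pnatr_eq0.
lin_eq.
Qed.

Definition jpow x n := iter n (jmul x) jone.

(** [Lop_mul3] expresses the multiplication by a power through those by [x], [x^2] and the two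
    preceding powers, so the induction carries two consecutive powers. *)
Lemma Lop_jpow_commute (T : V -> V) x :
    (forall y z, T (y + z) = T y + T z) -> (forall y, T (- y) = - T y) ->
    (forall y, T (x ** y) = x ** T y) ->
    (forall y, T ((x ** x) ** y) = (x ** x) ** T y) ->
  forall n y, T (jpow x n ** y) = jpow x n ** T y.
Proof.
move=> TD TN Tx Txx n y.
suff: (forall y, T (jpow x n ** y) = jpow x n ** T y) /\
      (forall y, T (jpow x n.+1 ** y) = jpow x n.+1 ** T y) by case.
elim: n {y} => [|n [IH0 IH1]]; split=> // y; rewrite ?jmul1 //=.
  by rewrite /= jmulr1.
rewrite (jmulxC x) !Lop_mul3 !(TD, TN, Tx) (jmulxC _ x).
by rewrite -/(jpow x n.+1) !(IH0, IH1, Tx, Txx).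
Qed.

Lemma Lop_jpowC x m n y :
  jpow x m ** (jpow x n ** y) = jpow x n ** (jpow x m ** y).
Proof.
have xC k z : x ** (jpow x k ** z) = jpow x k ** (x ** z).
  apply: (Lop_jpow_commute (T := jmul x)) => *; rewrite ?jmulDr ?jmulNr //.
  exact: esym (jordan_identity _ _).
have xxC k z : (x ** x) ** (jpow x k ** z) = jpow x k ** ((x ** x) ** z).
  apply: (Lop_jpow_commute (T := jmul (x ** x))) => *; rewrite ?jmulDr ?jmulNr //.
  exact: jordan_identity.
by apply: (Lop_jpow_commute (T := jmul (jpow x m))) => *;
  rewrite ?jmulDr ?jmulNr ?xC ?xxC.
Qed.

Lemma jpowD x m n : jpow x m ** jpow x n = jpow x (m + n).
Proof.
elim: m => [|m IHm]; first exact: jmul1.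
rewrite addSn /= -IHm (jmulxC _ (jpow x n)) (jmulxC (jpow x m)).
have := Lop_jpowC x n 1 (jpow x m).
by rewrite /= jmulr1.
Qed.

End JordanIdentities.
Arguments lin_combine {R V} k {x y x' y'}.

(** * Bounded operators *)

Section NormedPreliminaries.
Context {R : realType}.

Lemma dominated_increments_cvg (V : completeNormedModType R) (u : nat -> V)
    (b : nat -> R) M :
    (forall n, `|u n.+1 - u n| <= b n.+1 - b n) -> (forall n, b n <= M) ->
  cvgn u.
Proof.
move=> ub bM.
have sc : cvgn (series (telescope u)).
  apply: normed_cvg; apply: nondecreasing_is_cvgn.
    apply/nondecreasing_seqP => n; rewrite /normed_series_of !seriesEnat /= big_nat_recr //=.
    by rewrite lerDl normr_ge0.
  exists (M - b 0%N) => _ [n _ <-]; apply: (@le_trans _ _ (b n - b 0%N)).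
    rewrite /normed_series_of seriesEnat /= -(telescope_sumr b (leq0n n)).
    by apply: ler_sum => i _; exact: ub.
  by rewrite lerB.
have -> : u = cst (u 0%N) + series (telescope u).
  by apply/funext => n; exact: eq_sum_telescope.
by apply: is_cvgD => //; exact: is_cvg_cst.
Qed.

Lemma linear_bound_continuous (V W : normedModType R) (T : V -> W) C :
  linear T -> (forall y, `|T y| <= C * `|y|) -> continuous T.
Proof.
move=> Tlin TC.
pose Tl : {linear V -> W} := HB.pack T (GRing.isLinear.Build R V W *:%R T Tlin).
apply: (@linear_bounded_continuous _ _ _ Tl).1; apply/linear_boundedP.
near=> r => y; apply: le_trans (TC y) _; rewrite ler_wpM2r //.
by near: r; apply: nbhs_pinfty_ge; exact: num_real.
Unshelve. all: by end_near.
Qed.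

Lemma bounded_linear_operator (V : normedModType R) (T : V -> V) C :
  linear T -> (forall y, `|T y| <= C * `|y|) -> bounded_operator T.
Proof.
move=> Tlin TC; split=> // r; exists (`|C| * `|r|) => y yr.
apply: le_trans (TC y) _; apply: le_trans (ler_norm _) _.
by rewrite normrM normr_id ler_wpM2l // (le_trans yr (ler_norm _)).
Qed.

Lemma bounded_operatorP (V : normedModType R) (T : V -> V) :
  bounded_operator T -> exists2 C, 0 < C & forall y, `|T y| <= C * `|y|.
Proof.
move=> [Tlin /(_ 1) [M TM]]; exists (`|M| + 1); first by rewrite ltr_wpDl.
pose Tl : {linear V -> V} := HB.pack T (GRing.isLinear.Build R V V *:%R T Tlin).
move=> y; have [->|y0] := eqVneq y 0.
  by rewrite -[T]/(Tl : V -> V) raddf0 normr0 mulr0.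
have ny : 0 < `|y| by rewrite normr_gt0.
have := TM (`|y|^-1 *: y).
rewrite normrZ ger0_norm ?invr_ge0 // mulVf ?gt_eqF // => /(_ (lexx _)).
rewrite -[T]/(Tl : V -> V) linearZ normrZ ger0_norm ?invr_ge0 //.
rewrite ler_pdivrMl // => /le_trans; apply.
by rewrite mulrC ler_wpM2r // (le_trans (ler_norm _)) // lerDl.
Qed.

(** The Neumann series; the closed set [S] keeps the solution inside a subalgebra when that is
    wanted. *)
Lemma affine_fixpoint (V : completeNormedModType R) (S : set V) (T : V -> V)
    k z :
    linear T -> 0 <= k -> k < 1 -> (forall y, `|T y| <= k * `|y|) ->
    closed S -> S 0 -> (forall y, S y -> S (z + T y)) ->
  exists2 y, S y & y = z + T y.
Proof.
move=> Tlin k0 k1 Tk Scl S0 ST.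
pose u n := iter n (fun y => z + T y) 0.
have TB a b : T (a - b) = T a - T b.
  by rewrite addrC -scaleN1r Tlin scaleN1r addrC.
have T0 : T 0 = 0 by have := TB 0 0; rewrite !subrr.
have uS n : S (u n) by elim: n => //= n; exact: ST.
have uc : cvgn u.
  (* Minus the tail of the geometric series: its increments are [|z| k^n] and it stays below 0. *)
  apply: (@dominated_increments_cvg _ _ (fun n => - (`|z| * k ^+ n / (1 - k))) 0).
    move=> n; rewrite exprS.
    have -> : - (`|z| * (k * k ^+ n) / (1 - k)) - - (`|z| * k ^+ n / (1 - k)) =
        k ^+ n * `|z| by field; rewrite subr_eq0 gt_eqF.
    elim: n => [|n IHn].
      by rewrite /= T0 addr0 subr0 mul1r.
    rewrite /= opprD addrACA subrr add0r -TB exprS -mulrA.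
    by apply: le_trans (Tk _) _; rewrite ler_wpM2l.
  move=> n; rewrite oppr_le0 divr_ge0 ?subr_ge0 ?(ltW k1) //.
  by rewrite mulr_ge0 ?exprn_ge0.
exists (lim (u @ \oo)).
  by apply: (closed_cvg _ Scl _ _ uc); apply: nearW.
have Tc := linear_bound_continuous Tlin Tk.
have h1 : (z + T (u n)) @[n --> \oo] --> z + T (lim (u @ \oo)).
  by apply: cvgD; [exact: cvg_cst | apply: continuous_cvg uc; exact: Tc].
have h2 : (z + T (u n)) @[n --> \oo] --> lim (u @ \oo).
  have -> : (fun n => z + T (u n)) = (fun n => u (n + 1)%N).
    by apply/funext => n; rewrite addn1.
  by rewrite cvg_shiftn.
by apply: (cvg_unique _ h2 h1); exact: norm_hausdorff.
Qed.

(** [A] commutes with [C = A B = B A], so [B C^-1] inverts [A] on both sides. This passes from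
    [1 - T^2] to [1 - T] and [1 + T]. *)
Lemma invertible_factor (V : normedModType R) (A B C : V -> V) :
    bounded_operator A -> bounded_operator B -> invertible_operator C ->
    (forall y, A (B y) = C y) -> (forall y, B (A y) = C y) ->
  invertible_operator A.
Proof.
move=> bA bB [bC [D [bD CK DK]]] AB BA; split=> //.
have AC y : A (C y) = C (A y) by rewrite -BA AB.
exists (fun y => B (D y)); split.
- have [c c0 Bc] := bounded_operatorP bB; have [d d0 Dd] := bounded_operatorP bD.
  apply: (@bounded_linear_operator _ _ (c * d)).
    by move=> k a b; rewrite bD.1 bB.1.
  move=> y; apply: le_trans (Bc _) _; rewrite -mulrA.
  by rewrite ler_wpM2l // ltW.
- by move=> y; rewrite -[y in A y]DK AC CK BA DK.
- by move=> y; rewrite AB DK.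
Qed.

Lemma neumann_invertible (V : completeNormedModType R) (T : V -> V) k :
    linear T -> 0 <= k -> k < 1 -> (forall y, `|T y| <= k * `|y|) ->
  invertible_operator (fun y => y - T y).
Proof.
move=> Tlin k0 k1 Tk.
have lin : linear (fun y => y - T y).
  by move=> a y z; rewrite Tlin scalerBr opprD addrACA.
have bd y : (1 - k) * `|y| <= `|y - T y|.
  rewrite mulrBl mul1r lerBlDr -lerBlDl; apply: le_trans (Tk y) => //.
  by rewrite lerBlDl -{1}(subrK (T y) y) ler_normD.
have sol z : exists y, y - T y = z.
  have [y _ yE] := affine_fixpoint Tlin k0 k1 Tk closedT I (fun _ _ => I) (z := z).
  by exists y; rewrite {1}yE addrK.
have k1' : 0 < 1 - k by rewrite subr_gt0.
have inj y z : y - T y = z - T z -> y = z.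
  move=> yz; apply/eqP; rewrite -subr_eq0 -normr_le0 -(pmulr_rle0 _ k1').
  have -> : y - z = -1 *: z + y by rewrite scaleN1r addrC.
  by apply: le_trans (bd _) _; rewrite lin yz scaleN1r addNr normr0.
have /boolp.choice [S SE] := sol.
split.
  apply: (@bounded_linear_operator _ _ (1 + k)) => // y.
  by rewrite mulrDl mul1r (le_trans (ler_normB _ _)) // lerD2l.
exists S; split=> [|y|y]; [|by apply: inj; rewrite SE|exact: SE].
apply: (@bounded_linear_operator _ _ (1 - k)^-1).
  by move=> a y z; apply: inj; rewrite lin !SE.
by move=> y; rewrite ler_pdivlMl // (le_trans (bd _)) // SE.
Qed.

End NormedPreliminaries.

(** * Closed associative subalgebras of a JB-algebra *)

Section JBAlgebra.
Context {R : realType} {V : jbAlgType R}.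
Local Notation "x ** y" := (@jmul R V x y) (at level 40, left associativity).
Local Notation "\1" := (@jone R V).
Implicit Types (a b c s u v w x y z : V) (S : set V).

Lemma jmul_linear a : linear (jmul a).
Proof. by move=> k y z; rewrite jmulDr jmulZr. Qed.

Lemma jmul_continuous a : continuous (jmul a).
Proof.
apply: (@linear_bound_continuous _ V V _ `|a|).
  exact: jmul_linear.
exact: jb_normM.
Qed.

Lemma jb_idempotent_le1 a : a ** a = a -> `|a| <= 1.
Proof.
move=> aa; have := jb_norm_sqr a; rewrite aa expr2.
have [->|a0] := eqVneq `|a| 0; first by rewrite ler01.
by rewrite -[X in X = _]mulr1 => /(mulfI a0) <-.
Qed.

Lemma norm_jone_le1 : `|\1| <= 1.
Proof. by apply: jb_idempotent_le1; rewrite jmul1. Qed.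

Lemma Uop_linear x : linear (Uop x).
Proof. by move=> k y z; rewrite UopD UopZ. Qed.

Lemma Uop_norm x y : `|Uop x y| <= 3 * `|x| ^+ 2 * `|y|.
Proof.
rewrite /Uop /Lop; apply: le_trans (ler_normB _ _) _.
rewrite normrZ normr_nat.
have h1 : `|x ** (x ** y)| <= `|x| ^+ 2 * `|y|.
  by rewrite expr2 -mulrA (le_trans (jb_normM _ _)) // ler_wpM2l // jb_normM.
have h2 : `|(x ** x) ** y| <= `|x| ^+ 2 * `|y|.
  by rewrite -jb_norm_sqr jb_normM.
by lra.
Qed.

(* Commuting multiplication operators make such a subspace an associative
   algebra that acts on all of V. *)
Record closed_assoc S : Prop := ClosedAssoc {
  ca1 : S \1;
  caD : forall a b, S a -> S b -> S (a + b);
  caZ : forall k a, S a -> S (k *: a);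
  caM : forall a b, S a -> S b -> S (a ** b);
  caLC : forall a b y, S a -> S b -> a ** (b ** y) = b ** (a ** y);
  ca_closed : closed S }.

Inductive jpoly x : set V :=
| jpoly0 : jpoly x 0
| jpolyS k n a : jpoly x a -> jpoly x (k *: jpow x n + a).

Lemma jpolyD x a b : jpoly x a -> jpoly x b -> jpoly x (a + b).
Proof.
by move=> xa xb; elim: xa => [|k n c _ IH]; rewrite ?add0r // -addrA; constructor.
Qed.

Lemma jpolyZ x k a : jpoly x a -> jpoly x (k *: a).
Proof.
elim=> [|l n c _ IH]; first by rewrite scaler0; constructor.
by rewrite scalerDr scalerA; constructor.
Qed.

Lemma jpolyX x n : jpoly x (jpow x n).
Proof. by rewrite -[jpow x n]scale1r -[_ *: _]addr0; do 2!constructor. Qed.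

Lemma jpolyM x a b : jpoly x a -> jpoly x b -> jpoly x (a ** b).
Proof.
move=> xa xb; elim: xa => [|k n c _ IH]; first by rewrite jmul0; constructor.
rewrite jmulDl; apply: jpolyD => //; rewrite jmulZl; apply: jpolyZ.
elim: xb => [|l m d _ {}IH]; first by rewrite jmulr0; constructor.
by rewrite jmulDr jmulZr jpowD; constructor.
Qed.

Lemma jpolyLC x a b y :
  jpoly x a -> jpoly x b -> a ** (b ** y) = b ** (a ** y).
Proof.
move=> xa xb; elim: xa => [|k n c _ IH]; first by rewrite !jmul0 jmulr0.
rewrite !jmulDl jmulDr IH; congr (_ + _); rewrite !jmulZl jmulZr; congr (_ *: _).
elim: xb => [|l m d _ {}IH]; first by rewrite !jmul0 jmulr0.
by rewrite !jmulDl jmulDr IH !jmulZl jmulZr Lop_jpowC.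
Qed.

Definition subalg x : set V := closure (jpoly x).

Lemma closure_min (T : topologicalType) (A P : set T) :
  closed P -> A `<=` P -> closure A `<=` P.
Proof. by move=> /closure_id {2}-> /closure_subset. Qed.

Lemma closed_eqfun (T : topologicalType) (f g : T -> V) :
  continuous f -> continuous g -> closed [set a | f a = g a].
Proof.
move=> fc gc; have -> : [set a | f a = g a] = (f \- g) @^-1` [set 0].
  apply/seteqP; split=> a /=; first by move=> ->; rewrite subrr.
  by move=> /eqP; rewrite subr_eq0 => /eqP.
apply: preimage_closed.
  move=> a _; apply: cvgB; [exact: fc|exact: gc].
apply: accessible_closed_set1; apply: hausdorff_accessible.
exact: norm_hausdorff.
Qed.

Lemma jmulr_continuous a : continuous (fun y => y ** a).
Proof.
by have -> : (fun y => y ** a) = jmul a;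
  [apply/funext => y; exact: jmulxC | exact: jmul_continuous].
Qed.

Lemma preimage_closed_setT (f : V -> V) (P : set V) :
  continuous f -> closed P -> closed (f @^-1` P).
Proof. by move=> fc; apply: preimage_closed => y _; exact: fc. Qed.

Lemma subalg_closed_assoc x : closed_assoc (subalg x).
Proof.
have cl : closed (subalg x) by exact: closed_closure.
have sub a : jpoly x a -> subalg x a by exact: subset_closure.
have addc a : continuous (fun b : V => b + a).
  by move=> b; apply: cvgD; [exact: cvg_id|exact: cvg_cst].
split=> //.
- exact: sub (jpolyX x 0).
- move=> a b xa; move: b; apply: closure_min => [|b xb].
    apply: (preimage_closed_setT (f := fun b => a + b)) => //.
    by have -> : (fun b => a + b) = (fun b => b + a);
      [apply/funext => b; exact: addrC|].
  move: a xa; apply: closure_min => [|a xa].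
    exact: (preimage_closed_setT (f := fun a => a + b)).
  by apply: sub; exact: jpolyD.
- move=> k a; move: a; apply: closure_min => [|a xa].
    apply: (preimage_closed_setT (f := fun a => k *: a)) => //.
    exact: scaler_continuous.
  by apply: sub; exact: jpolyZ.
- move=> a b xa; move: b; apply: closure_min => [|b xb].
    by apply: preimage_closed_setT cl; exact: jmul_continuous.
  move: a xa; apply: closure_min => [|a xa].
    by apply: preimage_closed_setT cl; exact: jmulr_continuous.
  by apply: sub; exact: jpolyM.
- move=> a b y xa; move: b; apply: closure_min => [|b xb].
    apply: closed_eqfun => b; last exact: jmulr_continuous.
    exact: (continuous_comp (@jmulr_continuous y b) (@jmul_continuous a (b ** y))).
  move: a xa; apply: closure_min => [|a xa].
    apply: closed_eqfun => a; first exact: jmulr_continuous.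
    exact: (continuous_comp (@jmulr_continuous y a) (@jmul_continuous b (a ** y))).
  exact: jpolyLC xa xb.
Qed.

Lemma subalg_id x : subalg x x.
Proof. by apply: subset_closure; have := jpolyX x 1; rewrite /= jmulr1. Qed.

(** Powers are iterates of [L_x] on the unit, so stability of [P] under [L_x] reaches every
    polynomial, and closedness the rest. *)
Lemma subalg_min x (P : set V) :
    closed P -> P \1 -> (forall a b, P a -> P b -> P (a + b)) ->
    (forall k a, P a -> P (k *: a)) -> (forall a, P a -> P (x ** a)) ->
  subalg x `<=` P.
Proof.
move=> Pcl P1 PD PZ PM; apply: closure_min => // a; elim=> [|k n b _ Pb].
  by rewrite -(scale0r \1); exact: PZ.
by apply: PD Pb; apply: PZ; elim: n => //= n; exact: PM.
Qed.

End JBAlgebra.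

(** * Square roots and inverses *)

Section FunctionalCalculus.
Context {R : realType} {V : jbAlgType R}.
Local Notation "x ** y" := (@jmul R V x y) (at level 40, left associativity).
Local Notation "\1" := (@jone R V).
Implicit Types (a b c s u v w x y z : V) (S : set V).

Lemma jdiff_sqr a b : (a - b) ** (a + b) = a ** a - b ** b.
Proof. by rewrite !jmulE (jmulxC b a); lin_eq. Qed.

(** The equation for [y] is [y = (u + y^2)/2]. The iteration from 0 is dominated by the same one
    over the reals with [u = 1], which increases and stays below 1; this covers [|u| = 1], where a
    contraction argument fails. *)
Lemma sqrt_one_sub S u : closed_assoc S -> S u -> `|u| <= 1 ->
  exists y, [/\ S y, `|y| <= 1 & (\1 - y) ** (\1 - y) = \1 - u].
Proof.
move=> hS Su u1.
pose a n : R := iter n (fun r => 2^-1 * (1 + r ^+ 2)) 0.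
pose y n : V := iter n (fun y => 2^-1 *: (u + y ** y)) 0.
have a01 n : 0 <= a n <= 1.
  elim: n => [|n /andP[h0 h1]] /=; first by rewrite lexx ler01.
  have : 0 <= a n ^+ 2 <= 1 by rewrite exprn_ge0 //= exprn_ile1.
  by rewrite -/(a n); lra.
have a0 n : 0 <= a n by case/andP: (a01 n).
have a1 n : a n <= 1 by case/andP: (a01 n).
have ya n : `|y n| <= a n.
  elim: n => [|n IHn] /=; first by rewrite normr0.
  rewrite normrZ ger0_norm ?invr_ge0 // ler_wpM2l ?invr_ge0 //.
  apply: le_trans (ler_normD _ _) _; apply: lerD => //.
  by rewrite jb_norm_sqr lerXn2r ?nnegrE.
have yinc n : `|y n.+1 - y n| <= a n.+1 - a n.
  elim: n => [|n IHn].
    rewrite /= jmul0 addr0 !subr0 expr0n addr0 mulr1 normrZ ger0_norm ?invr_ge0 //.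
    by rewrite ler_piMr ?invr_ge0.
  have -> : y n.+2 - y n.+1 = 2^-1 *: ((y n.+1 - y n) ** (y n.+1 + y n)).
    by rewrite jdiff_sqr {1 2}/y /= -/(y n) -scalerBr opprD addrACA subrr add0r.
  have -> : a n.+2 - a n.+1 = 2^-1 * ((a n.+1 - a n) * (a n.+1 + a n)).
    rewrite {1 2}/a /= -/(a n); ring.
  rewrite normrZ ger0_norm ?invr_ge0 // ler_wpM2l ?invr_ge0 //.
  apply: le_trans (jb_normM _ _) _; apply: ler_pM => //.
  by apply: le_trans (ler_normD _ _) _; exact: lerD.
have yc : cvgn y by exact: (dominated_increments_cvg yinc a1).
have yS n : S (y n).
  elim: n => [|n IHn] /=; first by rewrite -(scale0r \1); apply: caZ hS _ _ (ca1 hS).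
  by apply: (caZ hS); apply: (caD hS) => //; exact: (caM hS).
set l := lim (y @ \oo) in yc.
have Sl : S l by apply: (closed_cvg _ (ca_closed hS) _ _ yc); exact: nearW.
have l1 : `|l| <= 1.
  have cl : closed [set z : V | `|z| <= 1].
    apply: (@preimage_closed _ _ (fun z : V => `|z|) [set r | r <= 1]).
      by move=> z _; exact: norm_continuous.
    exact: closed_le.
  apply: (closed_cvg _ cl _ _ yc); apply: nearW => n /=.
  exact: le_trans (ya n) (a1 n).
have sqc : y n ** y n @[n --> \oo] --> l ** l.
  apply/cvgrPdist_le => e e0.
  have e2 : 0 < e / 2 by rewrite divr_gt0.
  have /cvgrPdist_le /(_ _ e2) := yc; apply: filterS => n yn.
  rewrite -jdiff_sqr; apply: le_trans (jb_normM _ _) _.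
  have -> : e = e / 2 * 2 by field.
  apply: ler_pM => //; apply: le_trans (ler_normD _ _) _.
  by rewrite (natrD R 1 1); apply: lerD => //; exact: le_trans (ya n) (a1 n).
have h1 : 2^-1 *: (u + y n ** y n) @[n --> \oo] --> 2^-1 *: (u + l ** l).
  by apply: cvgZr; apply: cvgD => //; exact: cvg_cst.
have h2 : 2^-1 *: (u + y n ** y n) @[n --> \oo] --> l.
  have -> : (fun n => 2^-1 *: (u + y n ** y n)) = (fun n => y (n + 1)%N).
    by apply/funext => n; rewrite addn1.
  by rewrite cvg_shiftn.
have lE : l = 2^-1 *: (u + l ** l).
  by apply: (cvg_unique _ h2 h1); exact: norm_hausdorff.
exists l; split => //.
rewrite !jmulE; apply: (lin_combine 1 (congr1 (fun z => 2 *: z) (esym lE)) (oner_neq0 _)).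
lin_eq.
Qed.

(** After scaling, [1 - z^2] is itself a square, and adding the square [z^2] to it gives 1, so the
    third norm axiom bounds it. *)
Lemma norm_sub_sqr m x : `|x| ^+ 2 <= m -> `|m *: \1 - x ** x| <= m.
Proof.
have key z : `|z| <= 1 -> `|\1 - z ** z| <= 1.
  move=> z1.
  have zz1 : `|z ** z| <= 1 by rewrite jb_norm_sqr exprn_ile1.
  have hS := subalg_closed_assoc z.
  have Sz : subalg z z by exact: subalg_id.
  have [y [_ _ yE]] := sqrt_one_sub hS (caM hS Sz Sz) zz1.
  rewrite -yE; apply: le_trans (jb_norm_sqrD _ z) _.
  by rewrite yE subrK norm_jone_le1.
have [m0|m0 xm] := leP m 0.
  move=> xm; have x0 : x = 0.
    apply/eqP; rewrite -normr_eq0 -sqrf_eq0 eq_le exprn_ge0 // andbT.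
    exact: le_trans xm m0.
  have -> : m = 0 by apply/eqP; rewrite eq_le m0 (le_trans _ xm) // exprn_ge0.
  by rewrite x0 jmul0 scale0r subr0 normr0.
have [r r0 r2] : exists2 r : R, 0 < r & r ^+ 2 = m.
  by exists (Num.sqrt m); rewrite ?sqrtr_gt0 // sqr_sqrtr // ltW.
have -> : m *: \1 - x ** x = m *: (\1 - (r^-1 *: x) ** (r^-1 *: x)).
  by rewrite jmulZl jmulZr -r2; lin_eq; field; rewrite gt_eqF.
rewrite normrZ gtr0_norm // -[leRHS]mulr1 ler_wpM2l ?(ltW m0) // key //.
rewrite normrZ gtr0_norm ?invr_gt0 // mulrC ler_pdivrMr // mul1r.
by rewrite -ler_sqr ?nnegrE ?(ltW r0) // r2.
Qed.

Section ClosedAssoc.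
Variables (S : set V) (hS : closed_assoc S).

Lemma ca0 : S 0. Proof. by rewrite -(scale0r \1); exact: caZ (ca1 hS). Qed.

Lemma caB a b : S a -> S b -> S (a - b).
Proof. by move=> Sa Sb; rewrite -scaleN1r; apply: caD => //; exact: caZ. Qed.

Lemma caA a b c : S a -> S c -> (a ** b) ** c = a ** (b ** c).
Proof. by move=> Sa Sc; rewrite jmulxC (caLC hS) // (jmulxC c). Qed.

Lemma caACA a b c d : S a -> S b -> S c -> S d ->
  (a ** b) ** (c ** d) = (a ** c) ** (b ** d).
Proof.
move=> Sa Sb Sc Sd; rewrite !caA //; try exact: (caM hS).
by rewrite (caLC hS d Sb Sc).
Qed.

Lemma Uop_ca a b : S a -> S b -> Uop a b = (a ** a) ** b.
Proof. by move=> Sa Sb; rewrite /Uop /Lop caA // scaler_nat mulr2n addrK. Qed.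

Lemma Lop_UopC a b y : S a -> S b -> a ** Uop b y = Uop b (a ** y).
Proof.
move=> Sa Sb; rewrite /Uop /Lop jmulBr jmulZr !(caLC hS _ Sa Sb).
by rewrite (caLC hS _ Sa (caM hS Sb Sb)).
Qed.

Lemma UopC a b y : S a -> S b -> Uop a (Uop b y) = Uop b (Uop a y).
Proof.
move=> Sa Sb; rewrite {1 4}/Uop /Lop !UopB UopZ !Lop_UopC //.
exact: caM.
Qed.

(** By the fundamental formula [U_a U_(b^2) U_a = U_1], so [U_a] is injective; and
    [U_a U_b U_a = U_(U_a b) = U_a], where [U_a] cancels. *)
Lemma UopK a b y : S a -> S b -> a ** b = \1 -> Uop b (Uop a y) = y.
Proof.
move=> Sa Sb ab; have U1 : Uop a (b ** b) = \1.
  by rewrite Uop_ca //; [rewrite -caACA // ab jmul1 | exact: caM].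
have inj z z' : Uop a z = Uop a z' -> z = z'.
  move=> zz'; have key t : Uop a (Uop (b ** b) (Uop a t)) = t.
    by rewrite -fundamental_formula U1 Uop1.
  rewrite -(key z) -(key z') zz' //.
have Uab : Uop a b = a by rewrite Uop_ca // caA // ab jmulr1.
by apply: inj; rewrite -fundamental_formula Uab.
Qed.

(** Two square roots in a row: the fourth root [r] makes [r^2] the positive square root of [b],
    namely [|x|], and [sqr_dist] and [sqr_inj] apply to such roots. Only [b] is placed in [S]; [x]
    witnesses that it is a square. *)
Lemma sqr_root b x : S b -> b = x ** x ->
  exists2 r, S r & (r ** r) ** (r ** r) = b.
Proof.
move=> Sb bE; have [x0|x0] := eqVneq x 0.
  by exists 0; [exact: ca0|rewrite bE x0 !jmul0].
pose m := `|x| ^+ 2; have m0 : 0 < m by rewrite exprn_gt0 // normr_gt0.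
have u1 : `|\1 - m^-1 *: b| <= 1.
  have -> : \1 - m^-1 *: b = m^-1 *: (m *: \1 - x ** x).
    by rewrite scalerBr scalerA mulVf ?gt_eqF // scale1r bE.
  rewrite normrZ gtr0_norm ?invr_gt0 // ler_pdivrMl // mulr1.
  exact: norm_sub_sqr.
have Su : S (\1 - m^-1 *: b) by apply: caB (ca1 hS) _; exact: caZ.
have [y [Sy y1 yE]] := sqrt_one_sub hS Su u1.
have [z [Sz z1 zE]] := sqrt_one_sub hS Sy y1.
have [k k0 k2] : exists2 k : R, 0 < k & k ^+ 2 = `|x|.
  by exists (Num.sqrt `|x|); rewrite ?sqrtr_gt0 ?normr_gt0 // sqr_sqrtr.
exists (k *: (\1 - z)); first by apply: (caZ hS); exact: caB (ca1 hS) _.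
rewrite !(jmulZl, jmulZr) !scalerA zE yE opprB addrC subrK scalerA /m -k2.
by rewrite -[RHS]scale1r; congr (_ *: _); field; rewrite gt_eqF.
Qed.

(** For [p = a^2], [q = b^2] and [d = p - q], one has [(p^2 - q^2)^2 = d^2 (d^2 + 4 p q) = (d^2)^2 +
    (2 a b d)^2], and the third norm axiom applies. It gives uniqueness and continuity of positive
    square roots. *)
Lemma sqr_dist a b : S a -> S b ->
  `|a ** a - b ** b| ^+ 2 <= `|(a ** a) ** (a ** a) - (b ** b) ** (b ** b)|.
Proof.
move=> Sa Sb; set d := a ** a - b ** b.
have Saa : S (a ** a) by exact: caM.
have Sbb : S (b ** b) by exact: caM.
have Sab : S (a ** b) by exact: caM.
have Sd : S d by exact: caB.
have Sp : S (a ** a + b ** b) by exact: caD.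
have Sdd : S (d ** d) by exact: caM.
have pp : (a ** a + b ** b) ** (a ** a + b ** b) =
    d ** d + 4 *: ((a ** b) ** (a ** b)).
  by rewrite (caACA Sa Sb Sa Sb) /d !jmulE (jmulxC (b ** b) (a ** a)); lin_eq.
have E : (d ** d) ** (d ** d) + (2 *: ((a ** b) ** d)) ** (2 *: ((a ** b) ** d))
    = (d ** (a ** a + b ** b)) ** (d ** (a ** a + b ** b)).
  rewrite (caACA Sd Sp Sd Sp) pp jmulDr jmulZl jmulZr (caACA Sab Sd Sab Sd).
  by rewrite (jmulxC _ (d ** d)) jmulZr; lin_eq.
have := jb_norm_sqrD (d ** d) (2 *: ((a ** b) ** d)).
rewrite E jdiff_sqr 2!jb_norm_sqr (jb_norm_sqr (_ - _)) => h.
by rewrite -ler_sqr ?nnegrE ?exprn_ge0.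
Qed.

Lemma sqr_inj a b : S a -> S b ->
  (a ** a) ** (a ** a) = (b ** b) ** (b ** b) -> a ** a = b ** b.
Proof.
move=> Sa Sb ab; have := sqr_dist Sa Sb; rewrite ab subrr normr0 => h.
apply/eqP; rewrite -subr_eq0 -normr_eq0 -sqrf_eq0 eq_le exprn_ge0 //.
by rewrite andbT.
Qed.

Lemma neumann_ca z : S z -> `|z| < 1 -> exists2 q, S q & (\1 - z) ** q = \1.
Proof.
move=> Sz z1.
have [y Sy yE] := affine_fixpoint (jmul_linear z) (normr_ge0 z) z1
  (jb_normM z) (ca_closed hS) ca0
  (fun y Sy => caD hS (ca1 hS) (caM hS Sz Sy)).
by exists y => //; rewrite jmulBl jmul1 {1}yE addrK.
Qed.

Lemma sqr_add_invertible x e : S x -> 0 < e ->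
  exists q k, [/\ S q, S k, (x ** x + e *: \1) ** q = \1 &
    k ** k = x ** x + e *: \1].
Proof.
(* [x^2 + e = m (1 - z)] with [|z| <= |x|^2 / m < 1]. *)
move=> Sx e0; pose m := `|x| ^+ 2 + e.
have m0 : 0 < m by rewrite ltr_wpDl // exprn_ge0.
have zE : \1 - m^-1 *: (x ** x + e *: \1) =
    m^-1 *: (`|x| ^+ 2 *: \1 - x ** x).
  have {1}-> : \1 = m^-1 *: (m *: \1).
    by rewrite scalerA mulVf ?gt_eqF // scale1r.
  rewrite -scalerBr; congr (_ *: _); rewrite /m; lin_eq.
have Sxx : S (x ** x) by exact: caM.
set z := \1 - _ in zE.
have Sz : S z.
  apply: caB (ca1 hS) _; apply: (caZ hS); apply: (caD hS) => //.
  exact: caZ (ca1 hS).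
have z1 : `|z| < 1.
  rewrite zE normrZ gtr0_norm ?invr_gt0 // ltr_pdivrMl // mulr1.
  by apply: le_lt_trans (norm_sub_sqr (lexx _)) _; rewrite ltrDl.
have [q Sq qE] := neumann_ca Sz z1.
have [y [Sy _ yE]] := sqrt_one_sub hS Sz (ltW z1).
have [r r2] : exists r : R, r ^+ 2 = m by exists (Num.sqrt m); rewrite sqr_sqrtr ?ltW.
have zK : m *: (\1 - z) = x ** x + e *: \1.
  by rewrite subKr scalerA mulfV ?gt_eqF // scale1r.
exists (m^-1 *: q), (r *: (\1 - y)); split.
- exact: caZ.
- by apply: (caZ hS); exact: caB (ca1 hS) _.
- by rewrite -zK jmulZl jmulZr scalerA mulfV ?gt_eqF // scale1r.
- by rewrite jmulZl jmulZr scalerA yE -expr2 r2.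
Qed.

(** The inverse is sought inside [S]. Take [q = (x^2 + d/4)^-1]: then [d |q| <= |x^2 q| = |1 - (d/4)
    q| <= 1 + (d/4) |q|], so [(d/4) |q| <= 1/3] and [x^2 q] is invertible by a Neumann series. *)
Lemma sqr_invertible x d : S x -> 0 < d -> (forall a, d * `|a| <= `|Uop x a|) ->
  exists2 q, S q & (x ** x) ** q = \1.
Proof.
move=> Sx d0 xd; have e0 : 0 < d / 4 by rewrite divr_gt0.
have [q [_ [Sq _ qE _]]] := sqr_add_invertible Sx e0.
have Sxx : S (x ** x) by exact: caM.
have qd : d / 4 * `|q| < 1.
  have h := xd q; rewrite Uop_ca // in h.
  have h2 : `|(x ** x) ** q| <= 1 + d / 4 * `|q|.
    have -> : (x ** x) ** q = \1 - (d / 4) *: q.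
      by rewrite -qE jmulDl jmulZl jmul1 addrK.
    apply: le_trans (ler_normB _ _) _; rewrite normrZ (gtr0_norm e0).
    by rewrite lerD2r norm_jone_le1.
  have := le_trans h h2; lra.
have [q2 Sq2 q2E] : exists2 q2, S q2 & (\1 - (d / 4) *: q) ** q2 = \1.
  by apply: neumann_ca; [exact: caZ|rewrite normrZ gtr0_norm].
exists (q ** q2); first exact: caM.
rewrite -caA // -[RHS]q2E -qE; congr (_ ** _).
by rewrite jmulDl jmulZl jmul1 addrK.
Qed.

End ClosedAssoc.
End FunctionalCalculus.

(** * Symmetries *)

Section Symmetries.
Context {R : realType} {V : jbAlgType R}.
Local Notation "x ** y" := (@jmul R V x y) (at level 40, left associativity).
Local Notation "\1" := (@jone R V).
Implicit Types (a b c s u v w x y z : V) (S : set V).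

Lemma invertible_bounded_below (T : V -> V) : invertible_operator T ->
  exists2 d, 0 < d & forall y, d * `|y| <= `|T y|.
Proof.
move=> [_ [D [/bounded_operatorP[C C0 DC] TK _]]].
exists C^-1; first by rewrite invr_gt0.
by move=> y; rewrite ler_pdivrMl // -{1}(TK y).
Qed.

(* [w] is a fourth root of [x^2], [s] the sign of [x]. *)
Lemma polar_decomposition x : invertible x ->
  exists S s w v, [/\ closed_assoc S, [/\ S s, S w & S v],
    s ** s = \1, w ** v = \1 & x = Uop w s].
Proof.
move=> /invertible_bounded_below[d d0 xd].
have hS := subalg_closed_assoc x; have Sx : subalg x x by exact: subalg_id.
have [q Sq qE] := sqr_invertible hS Sx d0 xd.
have Sxx := caM hS Sx Sx.
have [r Sr rE] := sqr_root hS Sxx erefl.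
have Srr := caM hS Sr Sr; have Spq := caM hS Srr Sq.
have ppq : (r ** r) ** ((r ** r) ** q) = \1 by rewrite -(caA hS) // rE qE.
(* Here [p = r^2] and [q = x^-2], so [p q] is the inverse of [p]: the witnesses are [s = x p^-1],
   [w = r] and [v = r p^-1]. *)
exists (subalg x), (x ** ((r ** r) ** q)), r, (r ** ((r ** r) ** q)).
split => //.
- by split=> //; exact: (caM hS).
- rewrite (caACA hS) // (caACA hS Srr Sq Srr Sq) rE.
  have Sqq := caM hS Sq Sq; rewrite -(caA hS _ Sxx Sqq).
  by rewrite -(caACA hS Sxx Sq Sxx Sq) qE jmul1.
- by rewrite -(caA hS).
- have Ss := caM hS Sx Spq; rewrite (Uop_ca hS Sr Ss).
  by rewrite (caLC hS _ Srr Sx) ppq jmulr1.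
Qed.

(** Injectivity cancels one factor in [L_s^3 = L_s]. Then every [a] equals [s (s a)], so
    [symmetry_LopC] makes [L_a] commute with [L_s]. *)
Lemma symmetry_central s : s ** s = \1 -> (forall y, s ** y = 0 -> y = 0) ->
  (forall y, s ** (s ** y) = y) /\ (forall a y, a ** (s ** y) = s ** (a ** y)).
Proof.
move=> s2 ker0.
have sK y : s ** (s ** y) = y.
  apply/eqP; rewrite -subr_eq0; apply/eqP/ker0.
  by rewrite jmulBr symmetry_Lop3 // subrr.
by split=> // a y; have := symmetry_LopC (s ** a) y s2; rewrite sK.
Qed.

(** [U_w] carries the isotope of [U_w s] onto that of [s], whose product is [s (a b)] for central
    [s]; multiplication by [s] carries that onto [V]. *)
Lemma central_symmetry_isotope S s w v :
    closed_assoc S -> S s -> S w -> S v -> s ** s = \1 -> w ** v = \1 ->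
    (forall y, s ** y = 0 -> y = 0) ->
  jordan_isomorphic (isotope_mul (Uop w s)) (@jmul R V).
Proof.
move=> hS Ss Sw Sv s2 wv ker0; have [sK sC] := symmetry_central s2 ker0.
exists (fun a => s ** Uop w a); split.
- by move=> k a b; rewrite UopD UopZ jmulDr jmulZr.
- exists (fun b => Uop v (s ** b)) => a; first by rewrite sK (UopK hS).
  by rewrite (UopK hS) ?sK // jmulxC.
- move=> a b; rewrite /isotope_mul -Uop_Uop2 Uop2E /trip.
  set c := Uop w a; set d := Uop w b.
  have -> : (c ** s) ** d = s ** (c ** d).
    by rewrite (jmulxC c s) jmulxC sC (jmulxC d).
  by rewrite (sC c d) addrK sK (sC (s ** c)) (jmulxC (s ** c)) sC sK jmulxC.
Qed.

(** The polarized fundamental formula at the unit, since [U_s 1 = s^2 = 1]. *)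
Lemma Uop_symmetryM s a b : s ** s = \1 ->
  Uop s (a ** b) = Uop s a ** Uop s b.
Proof.
move=> s2; have := Uop_Uop2 s a b \1; rewrite Uop_jone s2 !Uop2E /trip.
by rewrite !jmulE !addrK.
Qed.

(* In V the symmetry [U_s] fixes [y^2], hence [d = |y|], so that [d] and [s]
   operator-commute and the squares of [y] and [d] in the isotope of [s] are
   opposite: [U_y s = - s y^2] and [U_d s = s y^2]. *)
Lemma isotope_symmetry_kernel s y : s ** s = \1 -> s ** y = 0 ->
  exists d, Uop y s + Uop d s = 0.
Proof.
move=> s2 sy; pose b := y ** y.
have hS := subalg_closed_assoc b; have Sb : subalg b b by exact: subalg_id.
have [r Sr rE] := sqr_root hS Sb erefl.
have Uy : Uop s y = - y.
  by rewrite /Uop /Lop sy s2 jmulr0 scaler0 jmul1 sub0r.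
have Ub : Uop s b = b by rewrite Uop_symmetryM // Uy jmulNl jmulNr opprK.
have fixS : subalg b `<=` [set z | Uop s z = z].
  apply: subalg_min => /=.
  - apply: closed_eqfun; last by move=> z; exact: cvg_id.
    exact: linear_bound_continuous (Uop_linear s) (Uop_norm s).
  - by rewrite Uop_jone.
  - by move=> a c; rewrite UopD => -> ->.
  - by move=> k a; rewrite UopZ => ->.
  - by move=> a; rewrite Uop_symmetryM // Ub => ->.
pose d := r ** r.
have Ud : Uop s d = d by apply: fixS; exact: (caM hS).
have sd : s ** (s ** d) = d.
  apply: (lin_combine 2 Ud); first by rewrite pnatr_eq0.
  by rewrite /Uop /Lop s2 jmul1; lin_eq.
(* As [d = s (s d)], it has the form [s a] that [symmetry_LopC] handles. *)
have dC z : d ** (s ** z) = s ** (d ** z).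
  by have := symmetry_LopC (s ** d) z s2; rewrite sd.
have ds : d ** s = s ** d by have := dC \1; rewrite !jmulr1.
exists d; rewrite /Uop /Lop ds dC rE (jmulxC y s) sy jmulr0 (jmulxC b).
by rewrite /b; lin_eq.
Qed.

(** [U_v] moves the vanishing sum of squares from the isotope of [s] to that of [U_w s], where the
    square of [U_v z] is [U_v U_z s]. *)
Lemma isotope_iso_kernel S s w v y :
    closed_assoc S -> S w -> S v -> s ** s = \1 -> w ** v = \1 ->
    jordan_isomorphic (isotope_mul (Uop w s)) (@jmul R V) ->
  s ** y = 0 -> y = 0.
Proof.
move=> hS Sw Sv s2 wv [f [flin /bij_inj finj fM]] sy.
have f0 : f 0 = 0.
  have := flin (-1) 0 0; rewrite scaler0 addr0 => ->.
  by rewrite scaleN1r addNr.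
have [d yd] := isotope_symmetry_kernel s2 sy.
have Uv z : Uop (Uop v z) (Uop w s) = Uop v (Uop z s).
  by rewrite fundamental_formula (UopK hS s Sw Sv wv).
have fsq z : f (Uop v (Uop z s)) = f (Uop v z) ** f (Uop v z).
  by rewrite -fM /isotope_mul Uop2xx Uv.
have ff : f (Uop v y) ** f (Uop v y) + f (Uop v d) ** f (Uop v d) = 0.
  by rewrite -!fsq -[f _]scale1r -flin scale1r -UopD yd Uop0 f0.
have fy : f (Uop v y) = 0.
  apply/eqP; rewrite -normr_eq0 -sqrf_eq0 eq_le exprn_ge0 // andbT.
  by rewrite -jb_norm_sqr (le_trans (jb_norm_sqrD _ (f (Uop v d)))) // ff normr0.
rewrite -(UopK hS y Sv Sw) ?(jmulxC v) //.
have -> : Uop v y = 0 by apply: finj; rewrite fy f0.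
by rewrite Uop0.
Qed.

End Symmetries.

(** * Positivity of U_p *)

Section Positivity.
Context {R : realType} {V : jbAlgType R}.
Local Notation "x ** y" := (@jmul R V x y) (at level 40, left associativity).
Local Notation "\1" := (@jone R V).
Implicit Types (a b c s u v w x y z : V) (S : set V).

Lemma add_Uop_bounded k a : bounded_operator (fun y => y + k *: Uop a y).
Proof.
apply: (@bounded_linear_operator _ _ _ (1 + `|k| * (3 * `|a| ^+ 2))) => [l y z|y].
  by rewrite Uop_linear; lin_eq.
rewrite mulrDl mul1r; apply: le_trans (ler_normD _ _) _.
by rewrite lerD2l normrZ -mulrA ler_wpM2l // Uop_norm.
Qed.

(** The constant 3 of [Uop_norm] keeps [|a| < 1] from giving a contraction at once. Since
    [1 - U_(a^2) = (1 - U_a)(1 + U_a)], repeated squaring of [a] absorbs it. *)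
Lemma sub_Uop_invertible n a : 3 * `|a| ^+ (2 ^ n * 2) < 1 ->
  invertible_operator (fun y => y + (-1) *: Uop a y).
Proof.
elim: n a => [|n IHn] a a1.
  have -> : (fun y => y + (-1) *: Uop a y) = (fun y => y - Uop a y).
    by apply/funext => y; rewrite scaleN1r.
  apply: neumann_invertible a1 _; rewrite ?expn0 ?mul1n.
  - exact: Uop_linear.
  - by rewrite mulr_ge0 ?exprn_ge0.
  - exact: Uop_norm.
apply: (@invertible_factor _ _ _ (fun y => y + 1 *: Uop a y)
    (fun y => y + (-1) *: Uop (a ** a) y)).
- exact: add_Uop_bounded.
- exact: add_Uop_bounded.
- apply: IHn; rewrite jb_norm_sqr -exprM; apply: le_lt_trans a1.
  by rewrite expnS mulnA.
- by move=> y; rewrite Uop_sqr UopD UopZ; lin_eq.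
- by move=> y; rewrite Uop_sqr UopD UopZ; lin_eq.
Qed.

Lemma add_Uop_invertible a : `|a| < 1 ->
  invertible_operator (fun y => y + 1 *: Uop a y).
Proof.
move=> a1.
have [n na] : exists n, 3 * `|a| ^+ n < 1.
  have a1' : `| `|a| | < 1 by rewrite normr_id.
  have e0 : 0 < (3^-1 : R) by rewrite invr_gt0.
  have /cvgrPdist_lt /(_ _ e0) [n _ nP] := cvg_expr a1'.
  exists n; have := nP n (leqnn n).
  rewrite /= sub0r normrN ger0_norm ?exprn_ge0 //.
  by rewrite -(ltr_pM2l (ltr0Sn R 2)) mulfV ?pnatr_eq0.
apply: (@invertible_factor _ _ _ (fun y => y + (-1) *: Uop a y)
    (fun y => y + (-1) *: Uop (a ** a) y)).
- exact: add_Uop_bounded.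
- exact: add_Uop_bounded.
- apply: (@sub_Uop_invertible n); rewrite jb_norm_sqr -exprM.
  apply: le_lt_trans na; rewrite ler_wpM2l // ler_wiXn2l // ?ltW //.
  apply: leq_trans (ltnW (ltn_expl n (ltnSn 1))) _.
  by rewrite mulnCA leq_pmulr.
- by move=> y; rewrite Uop_sqr UopD UopZ; lin_eq.
- by move=> y; rewrite Uop_sqr UopD UopZ; lin_eq.
Qed.

(* Cayley transform: with [p = w^2] and [a = (p - tau) (p + tau)^-1] one has
   [U_p + tau^2 = 1/2 (U_(p + tau) + U_(p - tau)) = 1/2 U_(p + tau) (1 + U_a)],
   and [1 - a^2 = 4 tau p (p + tau)^-2] is bounded below, so [|a| < 1]. *)
Section Cayley.
Variables (S : set V) (w v : V) (t : R).
Hypotheses (hS : closed_assoc S) (Sw : S w) (Sv : S v) (wv : w ** v = \1)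
  (t0 : 0 < t).
Let c := w ** w + t *: \1.
Let d := w ** w - t *: \1.

Lemma cayley_norm q : S q -> c ** q = \1 -> `|d ** q| < 1.
Proof.
move=> Sq cq.
have Sww := caM hS Sw Sw.
have St1 : S (t *: \1) by apply: (caZ hS); exact: ca1 hS.
have Sc : S c := caD hS Sww St1.
have Sd : S d := caB hS Sww St1.
have Scv := caM hS Sc Sv; have Swq := caM hS Sw Sq.
(* [c v] is the inverse of [w q]. This [e] lets [1 - e (c v)^2] have a square root [h] and keeps
   [1 - 4 t e] nonnegative. *)
pose e := (`|(c ** v) ** (c ** v)| + 1 + 4 * t)^-1.
have den : 0 < `|(c ** v) ** (c ** v)| + 1 + 4 * t.
  by rewrite addr_gt0 ?mulr_gt0 // ltr_wpDl.
have e0 : 0 < e by rewrite invr_gt0.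
have eu : e * `|(c ** v) ** (c ** v)| <= 1.
  by rewrite ler_pdivrMl // mulr1 -addrA lerDl addr_ge0 // mulr_ge0 // ltW.
have et : e * (4 * t) <= 1.
  by rewrite ler_pdivrMl // mulr1 lerDr addr_ge0.
have Su := caZ hS e (caM hS Scv Scv).
have [|g [Sg _ gE]] := sqrt_one_sub hS Su.
  by rewrite normrZ gtr0_norm.
set h := \1 - g in gE.
have Sh : S h := caB hS (ca1 hS) Sg.
have [r r2] : exists r : R, r * r = 4 * t.
  by exists (Num.sqrt (4 * t)); rewrite -expr2 sqr_sqrtr // mulr_ge0 // ltW.
have inv1 : (w ** q) ** (c ** v) = \1.
  by rewrite (jmulxC c) (caACA hS Sw Sq Sv Sc) wv jmul1 jmulxC.
(* [(d q)^2 = 1 - 4 t (w q)^2], while the second square is [4 t (w q)^2 - 4 t e]. *)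
have E : (d ** q) ** (d ** q) + (r *: ((w ** q) ** h)) ** (r *: ((w ** q) ** h))
    = (1 - e * (4 * t)) *: \1.
  have dd : d ** d = c ** c - (4 * t) *: (w ** w).
    by rewrite /d /c !jmulE; lin_eq.
  have Sqq := caM hS Sq Sq.
  rewrite jmulZl jmulZr scalerA r2 (caACA hS Swq Sh Swq Sh) gE.
  rewrite (caACA hS Sd Sq Sd Sq) dd jmulBl jmulZl.
  rewrite -(caACA hS Sc Sq Sc Sq) -(caACA hS Sw Sq Sw Sq) cq jmul1.
  rewrite jmulBr jmulZr -(caACA hS Swq Scv Swq Scv) inv1 !jmulE.
  by lin_eq.
have : `|d ** q| ^+ 2 <= 1 - e * (4 * t).
  rewrite -jb_norm_sqr; apply: le_trans (jb_norm_sqrD _ (r *: ((w ** q) ** h))) _.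
  rewrite E normrZ.
  rewrite ger0_norm ?subr_ge0 // ler_piMr ?subr_ge0 //; exact: norm_jone_le1.
have et0 : 0 < e * (4 * t) by rewrite !mulr_gt0.
move=> dq; rewrite -(@ltr_pXn2r _ 2) ?nnegrE // expr1n.
by apply: le_lt_trans dq _; rewrite ltrBlDr ltrDl.
Qed.

Lemma add_Uop_sqr_invertible :
  invertible_operator (fun y => Uop (w ** w) y + (t ^+ 2) *: y).
Proof.
have [q [k [Sq Sk cq kk]]] := sqr_add_invertible hS Sw t0; rewrite -/c in cq kk.
have Sww := caM hS Sw Sw.
have St1 : S (t *: \1) by apply: (caZ hS); exact: ca1 hS.
have Sc : S c := caD hS Sww St1.
have Sd : S d := caB hS Sww St1.
have Sa := caM hS Sd Sq.
have ka : Uop k (d ** q) = d.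
  by rewrite (Uop_ca hS Sk Sa) kk (caLC hS _ Sc Sd) cq jmulr1.
(* Since [d = U_k (d q)], [U_d = U_k U_(dq) U_k], and the commuting factors [U_k] combine to
   [U_(k^2) = U_c]. *)
have Ud y : Uop d y = Uop c (Uop (d ** q) y).
  by rewrite -{1}ka fundamental_formula (UopC hS _ Sa Sk) -kk Uop_sqr.
have Ucd y : 2 *: (Uop (w ** w) y + (t ^+ 2) *: y) = Uop c y + Uop d y.
  by rewrite /Uop /Lop /c /d !jmulE; lin_eq.
have half y : Uop (w ** w) y + (t ^+ 2) *: y =
    2^-1 *: Uop c (y + 1 *: Uop (d ** q) y).
  by rewrite UopD UopZ scale1r -Ud -Ucd scalerA mulVf ?pnatr_eq0 // scale1r.
have Uq : bounded_operator (fun y => 2 *: Uop q y).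
  apply: (@bounded_linear_operator _ _ _ (2 * (3 * `|q| ^+ 2))) => [l y z|y].
    by rewrite Uop_linear; lin_eq.
  by rewrite normrZ normr_nat -mulrA ler_wpM2l // Uop_norm.
apply: (invertible_factor _ Uq (add_Uop_invertible (cayley_norm Sq cq))).
- apply: (@bounded_linear_operator _ _ _ (3 * `|w ** w| ^+ 2 + t ^+ 2)).
    by move=> l y z; rewrite Uop_linear; lin_eq.
  move=> y; rewrite mulrDl; apply: le_trans (ler_normD _ _) _.
  by apply: lerD; [exact: Uop_norm | rewrite normrZ ger0_norm // exprn_ge0 // ltW].
- move=> y; rewrite half.
  have -> : 2 *: Uop q y + 1 *: Uop (d ** q) (2 *: Uop q y) =
      2 *: Uop q (y + 1 *: Uop (d ** q) y).
    by rewrite !UopD !UopZ (UopC hS _ Sa Sq); lin_eq.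
  by rewrite UopZ (UopK hS _ Sq Sc) ?(jmulxC q) // scalerA mulVf ?pnatr_eq0 ?scale1r.
- by move=> y; rewrite half UopZ (UopK hS _ Sc Sq cq); lin_eq.
Qed.
End Cayley.

Lemma central_symmetry_positive S s w v :
    closed_assoc S -> S s -> S w -> S v -> s ** s = \1 -> w ** v = \1 ->
    (forall y, s ** y = 0 -> y = 0) -> invertible (Uop w s) ->
  positive_operator (Uop (Uop w s)).
Proof.
move=> hS Ss Sw Sv s2 wv ker0 inv t /= tsp; have [sK _] := symmetry_central s2 ker0.
have UE y : Uop (Uop w s) y = Uop (w ** w) y.
  rewrite fundamental_formula Uop_sqr /Uop; congr (Uop w _).
  by rewrite /Uop /Lop sK s2 jmul1; lin_eq.
rewrite ltNge; apply/negP => t0; apply: tsp.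
have [t00|tn0] := eqVneq t 0.
  have -> // : (fun y => Uop (Uop w s) y - t *: y) = Uop (Uop w s).
  by apply/funext => y; rewrite t00 scale0r subr0.
have nt0 : 0 < - t by rewrite oppr_gt0 lt_neqAle tn0.
have -> : (fun y => Uop (Uop w s) y - t *: y) =
    (fun y => Uop (w ** w) y + (Num.sqrt (- t)) ^+ 2 *: y).
  by apply/funext => y; rewrite UE sqr_sqrtr ?ltW // scaleNr.
by apply: (add_Uop_sqr_invertible hS Sw Sv wv); rewrite sqrtr_gt0.
Qed.

End Positivity.

(** * Approximate eigenvectors on a Peirce space *)

Section PeirceHalfSpace.
Context {R : realType} {V : jbAlgType R}.
Local Notation "x ** y" := (@jmul R V x y) (at level 40, left associativity).
Local Notation "\1" := (@jone R V).
Implicit Types (a b c e s u v w x y z : V) (S M : set V).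

(* For an idempotent [e] the factor 2 makes [half_act e] multiplicative on the
   Peirce space [{y | e y = y / 2}]. *)
Definition half_act e a y : V := 2 *: ((a ** e) ** y).

Lemma half_actE e a y : half_act e a y = 2 *: ((a ** e) ** y).
Proof. by []. Qed.

Lemma half_act0 e a : half_act e a 0 = 0.
Proof. by rewrite /half_act jmulr0 scaler0. Qed.

Lemma half_actDl e a b y : half_act e (a + b) y = half_act e a y + half_act e b y.
Proof. by rewrite /half_act !jmulE; lin_eq. Qed.

Lemma half_actBl e a b y : half_act e (a - b) y = half_act e a y - half_act e b y.
Proof. by rewrite /half_act !jmulE; lin_eq. Qed.

Lemma half_actZl e k a y : half_act e (k *: a) y = k *: half_act e a y.
Proof. by rewrite /half_act !jmulE; lin_eq. Qed.

Lemma half_actZ e a k y : half_act e a (k *: y) = k *: half_act e a y.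
Proof. by rewrite /half_act !jmulE; lin_eq. Qed.

Lemma half_actB e a y z : half_act e a (y - z) = half_act e a y - half_act e a z.
Proof. by rewrite /half_act !jmulE; lin_eq. Qed.

Lemma half_act1 e y : e ** y = 2^-1 *: y -> half_act e \1 y = y.
Proof. by rewrite /half_act jmul1 => ->; lin_eq. Qed.

Lemma half_act_norm e a y : e ** e = e -> `|half_act e a y| <= 2 * `|a| * `|y|.
Proof.
move=> ee; rewrite normrZ normr_nat -mulrA ler_wpM2l //.
apply: le_trans (jb_normM _ _) _; rewrite ler_wpM2r //.
apply: le_trans (jb_normM _ _) _; rewrite ler_piMr //.
exact: jb_idempotent_le1.
Qed.

Lemma sqr_sub_one S c k : closed_assoc S -> S c -> 0 < k -> `|c| <= k ->
  exists2 q, S q & q ** q = k *: \1 - c.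
Proof.
move=> hS Sc k0 ck.
have Su : S (k^-1 *: c) by exact: (caZ hS).
have [|y [Sy _ yE]] := sqrt_one_sub hS Su.
  by rewrite normrZ gtr0_norm ?invr_gt0 // ler_pdivrMl // mulr1.
have [r r2] : exists r : R, r * r = k.
  by exists (Num.sqrt k); rewrite -expr2 sqr_sqrtr // ltW.
exists (r *: (\1 - y)); first by apply: (caZ hS); exact: caB hS _ _ (ca1 hS) Sy.
rewrite jmulZl jmulZr scalerA r2 yE scalerBr scalerA mulfV ?gt_eqF //.
by rewrite scale1r.
Qed.

Section Action.
Variables (S : set V) (hS : closed_assoc S).

Lemma half_actC e f a b y : S e -> S f -> S a -> S b ->
  half_act e a (half_act f b y) = half_act f b (half_act e a y).
Proof.
move=> Se Sf Sa Sb; have Sae := caM hS Sa Se; have Sbf := caM hS Sb Sf.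
by rewrite /half_act !jmulZr (caLC hS _ Sae Sbf).
Qed.

Lemma Lop_half_act e a b y : S e -> S a -> S b ->
  b ** half_act e a y = half_act e a (b ** y).
Proof.
move=> Se Sa Sb; have Sae := caM hS Sa Se.
by rewrite /half_act !jmulZr (caLC hS _ Sae Sb).
Qed.

(** For [A = a e] and [B = b e], [Lop_mul3] with third factor [e] reads
    [(A B) y = (A B) y / 2 + A (B y)], hence [(A B) y = 2 A (B y)]. *)
Lemma half_actM e a b y : S e -> e ** e = e -> S a -> S b ->
  e ** y = 2^-1 *: y -> half_act e (a ** b) y = half_act e a (half_act e b y).
Proof.
move=> Se ee Sa Sb ey; have Sae := caM hS Sa Se; have Sbe := caM hS Sb Se.
have abe : (a ** b) ** e = (a ** e) ** (b ** e).
  by rewrite -{1}ee (caACA hS).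
have aee : (a ** e) ** e = a ** e by rewrite (caA hS) ?ee.
have bee : (b ** e) ** e = b ** e by rewrite (caA hS) ?ee.
have abee : ((a ** e) ** (b ** e)) ** e = (a ** e) ** (b ** e).
  by rewrite (caA hS) // bee.
have := Lop_mul3 (a ** e) (b ** e) e y.
rewrite abee bee (jmulxC e (a ** e)) aee.
rewrite (caLC hS _ Se (caM hS Sae Sbe)) (caLC hS _ Se Sbe) (caLC hS _ Se Sae).
rewrite ey !jmulZr (caLC hS _ Sbe Sae) => h.
rewrite /half_act abe jmulZr.
by apply: (lin_combine (4^-1) h); [rewrite invr_eq0 pnatr_eq0 | lin_eq].
Qed.

(* With [g k = (c - t_k)^+] on a fine grid [t_0 < ... < t_n], take the last [k]
   for which [g k] acts nontrivially on [M]: on [g k M], [c] acts almost as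
   [t_k]. *)
Lemma approximate_eigenspace e c (eps : R) (M : set V) :
    S e -> e ** e = e -> S c -> 0 < eps ->
    (forall y, M y -> e ** y = 2^-1 *: y) -> (exists2 y, M y & y != 0) ->
  exists t g, [/\ S g, `|t| <= 2 * `|c| + 1,
    exists2 y, M y & half_act e g y != 0 &
    forall y, M y -> `|half_act e c (half_act e g y) - t *: half_act e g y| <=
      eps * `|half_act e g y|].
Proof.
move=> Se ee Sc eps0 Me [y0 My0 y00].
(* As [c] acts with norm at most [2 |c| < K], [g 0 = c + K] cannot act as zero, while [|c| <= K]
   forces [g n = 0]. *)
pose K := 2 * `|c| + 1; have K1 : 1 <= K by rewrite /K lerDr mulr_ge0.
have K0 : 0 < K by exact: lt_le_trans K1.
have cK : 2 * `|c| < K by rewrite /K ltrDl.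
have cK' : `|c| <= K by have := normr_ge0 c; lra.
(* One grid step changes [d k] by at most [eta <= eps / 2] and, by [sqr_dist], its absolute value by
   at most the square root of [4 K eta], also [<= eps / 2]. *)
pose m := Num.min (eps / 2) (eps ^+ 2 / (16 * K)).
have m0 : 0 < m by rewrite lt_min !divr_gt0 ?mulr_gt0 ?exprn_gt0.
have X0 : 0 < 2 * K / m by rewrite divr_gt0 ?mulr_gt0.
pose n := Num.bound (2 * K / m).
have nX : 2 * K / m < n%:R by apply: archi_boundP; exact: ltW.
have n0 : 0 < (n%:R : R) by exact: lt_trans nX.
pose eta := 2 * K / n%:R.
have eta0 : 0 < eta by rewrite divr_gt0 ?mulr_gt0.
have etam : eta <= m.
  by rewrite /eta ler_pdivrMr // -ler_pdivrMl // [leLHS]mulrC ltW.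
have eta1 : eta <= eps / 2 by apply: le_trans etam _; rewrite ge_min lexx.
have eta2 : 4 * K * eta <= (eps / 2) ^+ 2.
  have : eta <= eps ^+ 2 / (16 * K).
    by apply: le_trans etam _; rewrite ge_min lexx orbT.
  by rewrite ler_pdivlMr ?mulr_gt0 // expr_div_n => h; lra.
pose t k : R := - K + k%:R * eta.
have tn : t n = K by rewrite /t /eta mulrC divfK ?gt_eqF //; lra.
have tK k : (k <= n)%N -> `|t k| <= K.
  move=> kn; have h0 : 0 <= k%:R * eta by rewrite mulr_ge0 // ltW.
  have h1 : k%:R * eta <= n%:R * eta by rewrite ler_wpM2r ?ler_nat // ltW.
  by rewrite ler_norml -[X in _ && (_ <= X)]tn /t lerD2l h1 lerDl h0.
pose d k : V := c - t k *: \1.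
have Sd k : S (d k) by apply: (caB hS) => //; apply: (caZ hS); exact: ca1 hS.
have /boolp.choice [r rP] k : exists r, S r /\ (r ** r) ** (r ** r) = d k ** d k.
  by have [r Sr rE] := sqr_root hS (caM hS (Sd k) (Sd k)) erefl; exists r.
have Sr k : S (r k) by have [] := rP k.
have rE k : (r k ** r k) ** (r k ** r k) = d k ** d k by have [] := rP k.
have Srr k : S (r k ** r k) by exact: (caM hS).
(* [r k ** r k] is [|d k|], so [g k] and [h k] are the positive and negative parts of [d k]. *)
pose g k : V := 2^-1 *: (r k ** r k + d k).
pose h k : V := 2^-1 *: (r k ** r k - d k).
have Sg k : S (g k) by apply: (caZ hS); exact: (caD hS).
have Sh k : S (h k) by apply: (caZ hS); exact: (caB hS).
have hg k : h k ** g k = 0.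
  by rewrite jmulZl jmulZr jdiff_sqr rE subrr !scaler0.
have dE k : d k = g k - h k by rewrite /g /h; lin_eq.
have gdist k : (k < n)%N -> 2 * `|g k - g k.+1| <= eps.
  move=> kn.
  have dd : d k - d k.+1 = eta *: \1.
    by rewrite /d /t -natr1; lin_eq.
  have ddn : `|d k - d k.+1| <= eta.
    by rewrite dd normrZ gtr0_norm // ler_piMr ?(ltW eta0) // norm_jone_le1.
  have dn j : (j <= n)%N -> `|d j| <= 2 * K.
    move=> jn; apply: le_trans (ler_normB _ _) _; rewrite normrZ.
    have := tK j jn; have := norm_jone_le1 (V := V) => h1 h2.
    have : `|t j| * `|\1| <= K * 1 by apply: ler_pM.
    by lra.
  have rr : `|r k ** r k - r k.+1 ** r k.+1| <= eps / 2.
    rewrite -ler_sqr ?nnegrE ?normr_ge0 ?divr_ge0 ?(ltW eps0) //.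
    apply: le_trans (sqr_dist hS (Sr k) (Sr k.+1)) _; rewrite !rE -jdiff_sqr.
    apply: le_trans (jb_normM _ _) _; apply: le_trans eta2; rewrite mulrC.
    apply: ler_pM => //; apply: le_trans (ler_normD _ _) _.
    by have := dn k (ltnW kn); have := dn k.+1 kn; lra.
  have -> : g k - g k.+1 =
      2^-1 *: ((r k ** r k - r k.+1 ** r k.+1) + (d k - d k.+1)).
    by rewrite /g; lin_eq.
  rewrite normrZ ger0_norm ?invr_ge0 // mulVKf ?pnatr_eq0 //.
  by apply: le_trans (ler_normD _ _) _; lra.
pose P k := `[< forall y, M y -> half_act e (g k) y = 0 >].
have Pn : P n.
  have [q Sq qE] := sqr_sub_one hS Sc K0 cK'.
  have rq : r n ** r n = q ** q.
    by apply: (sqr_inj hS) => //; rewrite rE qE /d tn -opprB jmulNl jmulNr opprK.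
  apply/asboolP => y _; have -> : g n = 0 by rewrite /g rq qE /d tn; lin_eq.
  by rewrite /half_act !jmul0 scaler0.
have P0 : ~~ P 0%N.
  have [|q Sq qE] := sqr_sub_one hS (caZ hS (-1) Sc) K0.
    by rewrite scaleN1r normrN.
  have rq : r 0%N ** r 0%N = q ** q.
    apply: (sqr_inj hS) => //; rewrite rE qE.
    by congr (_ ** _); rewrite /d /t; lin_eq.
  have g0 : g 0%N = c + K *: \1 by rewrite /g rq qE /d /t; lin_eq.
  apply/asboolPn => /(_ _ My0); rewrite g0 half_actDl half_actZl half_act1; last exact: Me.
  move=> /eqP; rewrite addr_eq0 => /eqP E.
  have := half_act_norm c y0 ee; rewrite E normrN normrZ gtr0_norm // leNgt.
  by rewrite ltr_pM2r ?cK // normr_gt0.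
(* [j.+1] is the first index whose [g] annihilates [M], so [g j] does not. *)
have [[|j] Pj jmin] := ex_minnP (ex_intro P n Pn); first by rewrite Pj in P0.
have jn : (j < n)%N by exact: jmin.
have nPj : ~~ P j by apply/negP => /jmin; rewrite ltnn.
exists (t j), (g j); split.
- exact: Sg.
- exact: tK (ltnW jn).
- have /asboolPn := nPj; rewrite -existsNP => -[y].
  rewrite not_implyE => -[My gy]; exists y => //; exact/eqP.
- move=> y My; have ey := Me _ My.
  set z := half_act e (g j) y.
  have ez : e ** z = 2^-1 *: z by rewrite Lop_half_act // ey half_actZ.
  have -> : half_act e c z - t j *: z = half_act e (d j) z.
    by rewrite half_actBl half_actZl half_act1.
  have hz : half_act e (h j) z = 0.
    by rewrite -half_actM // hg /half_act !jmul0 scaler0.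
  have gz : half_act e (g j.+1) z = 0.
    rewrite half_actC //; have /asboolP -> // := Pj.
    exact: half_act0.
  (* [h j] kills [z], leaving [g j]; subtracting [g j.+1], which also kills [z], makes the
     coefficient small. *)
  rewrite dE half_actBl hz subr0 -[half_act _ _ _]subr0 -gz -half_actBl.
  apply: le_trans (half_act_norm _ _ ee) _.
  by rewrite ler_wpM2r // gdist.
Qed.

End Action.
End PeirceHalfSpace.

(** * A spectral gap excludes a kernel of [L_s] *)

Section SpectralGap.
Context {R : realType} {V : jbAlgType R}.
Local Notation "x ** y" := (@jmul R V x y) (at level 40, left associativity).
Local Notation "\1" := (@jone R V).
Implicit Types (a b c e s u v w x y z : V) (S M : set V).

(* On [ker L_s] one has [U_x = - F^2 F'^2] with commuting actions [F], [F'] of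
   [w], and a joint approximate eigenvector of [F] and [F'] yields an
   approximate eigenvalue [- (t1 t2)^2 <= 0] of [U_x]. *)
Lemma kernel_approximate_eigenvector S s w (eps : R) :
    closed_assoc S -> S s -> S w -> s ** s = \1 ->
    (exists2 y, s ** y = 0 & y != 0) -> 0 < eps ->
  let K := 2 * `|w| + 1 in
  exists t z, [/\ 0 <= t <= K ^+ 4, z != 0 &
    `|Uop (Uop w s) z + t *: z| <= 4 * K ^+ 3 * eps * `|z|].
Proof.
move=> hS Ss Sw s2 exy eps0 K.
have S1 := ca1 hS.
pose e := 2^-1 *: (\1 + s); pose f := 2^-1 *: (\1 - s).
have Se : S e by apply: (caZ hS); exact: (caD hS).
have Sf : S f by apply: (caZ hS); exact: (caB hS).
have ee : e ** e = e by rewrite /e !jmulE s2; lin_eq.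
have ff : f ** f = f by rewrite /f !jmulE s2; lin_eq.
have eN y : s ** y = 0 -> e ** y = 2^-1 *: y by move=> sy; rewrite /e !jmulE sy addr0.
have fN y : s ** y = 0 -> f ** y = 2^-1 *: y by move=> sy; rewrite /f !jmulE sy subr0.
have actN i a y : S i -> S a -> s ** y = 0 -> s ** half_act i a y = 0.
  by move=> Si Sa sy; rewrite (Lop_half_act hS) // sy half_act0.
have [t1 [g1 [Sg1 t1K [y1 sy1 gy1] ap1]]] :=
  @approximate_eigenspace _ _ S hS e w eps [set y | s ** y = 0] Se ee Sw eps0 eN exy.
pose M := [set half_act e g1 y | y in [set y | s ** y = 0]].
have fM y : M y -> f ** y = 2^-1 *: y.
  by move=> [z sz <-]; apply: fN; exact: actN.
have exM : exists2 y, M y & y != 0.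
  by exists (half_act e g1 y1) => //; exists y1.
have [t2 [g2 [Sg2 t2K [_ [y sy <-] z0] ap2]]] :=
  @approximate_eigenspace _ _ S hS f w eps M Sf ff Sw eps0 fM exM.
have := ap2 _ (ex_intro2 _ _ y sy erefl).
set z := half_act f g2 _ in z0 * => zf.
(* Commuting the two cut-offs puts [z] in the range of the first as well, so both estimates hold for
   it. *)
have zE : z = half_act e g1 (half_act f g2 y) by exact: (half_actC hS).
have ze : `|half_act e w z - t1 *: z| <= eps * `|z|.
  by rewrite zE; apply: ap1 => /=; exact: actN.
have sz : s ** z = 0 by rewrite zE; apply: (actN) => //; exact: actN.
have K0 : 0 <= K by rewrite addr_ge0 // mulr_ge0.
have wK : 2 * `|w| <= K by rewrite lerDl.
have Fn y' : `|half_act e w y'| <= K * `|y'|.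
  by apply: le_trans (half_act_norm _ _ ee) _; rewrite ler_wpM2r.
have Gn y' : `|half_act f w y'| <= K * `|y'|.
  by apply: le_trans (half_act_norm _ _ ff) _; rewrite ler_wpM2r.
have sqr_approx i t : (forall y', `|half_act i w y'| <= K * `|y'|) -> `|t| <= K ->
    `|half_act i w z - t *: z| <= eps * `|z| ->
    `|half_act i w (half_act i w z) - t ^+ 2 *: z| <= 2 * K * eps * `|z|.
  move=> iK tK it.
  have -> : half_act i w (half_act i w z) - t ^+ 2 *: z =
      half_act i w (half_act i w z - t *: z) + t *: (half_act i w z - t *: z).
    by rewrite half_actB (half_actZ i w t); lin_eq.
  apply: le_trans (ler_normD _ _) _; rewrite (normrZ t).
  have h1 := iK (half_act i w z - t *: z).
  have h2 : `|t| * `|half_act i w z - t *: z| <= K * (eps * `|z|) by exact: ler_pM.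
  have h3 : K * `|half_act i w z - t *: z| <= K * (eps * `|z|) by rewrite ler_wpM2l.
  apply: le_trans (lerD (le_trans h1 h3) h2) _; rewrite le_eqVlt; apply/orP; left.
  by apply/eqP; ring.
have zee := sqr_approx e t1 Fn t1K ze; have zff := sqr_approx f t2 Gn t2K zf.
have Sww := caM hS Sw Sw; have SU : S (Uop w s).
  by rewrite (Uop_ca hS) //; exact: (caM hS).
(* With [A] and [B] the actions of [w^2] through [e] and [f], [L_x = (A - B)/2] and
   [L_(x^2) = (A^2 + B^2)/2] here, so [U_x = -A B]. *)
have UE : Uop (Uop w s) z =
    - half_act e w (half_act e w (half_act f w (half_act f w z))).
  have fw : half_act f (w ** w) z = half_act f w (half_act f w z).
    exact: (half_actM hS Sf ff Sw Sw (fN _ sz)).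
  have sfz : s ** half_act f (w ** w) z = 0 by exact: actN.
  rewrite -fw -(half_actM hS Se ee Sw Sw (eN _ sfz)).
  have xe y' : Uop w s ** y' =
      2^-1 *: (half_act e (w ** w) y' - half_act f (w ** w) y').
    by rewrite (Uop_ca hS) // !half_actE /e /f !jmulE; lin_eq.
  have xx : Uop w s ** Uop w s = (w ** w) ** (w ** w).
    by rewrite (Uop_ca hS) // (caACA hS) // s2 jmulr1.
  have ppz : ((w ** w) ** (w ** w)) ** z =
      2^-1 *: (half_act e (w ** w) (half_act e (w ** w) z)
               + half_act f (w ** w) (half_act f (w ** w) z)).
    rewrite -(half_actM hS Se ee Sww Sww (eN _ sz)).
    rewrite -(half_actM hS Sf ff Sww Sww (fN _ sz)).
    by rewrite !half_actE /e /f !jmulE; lin_eq.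
  rewrite /Uop /Lop xx ppz !xe !(half_actZ _ _ (2^-1)) !half_actB.
  rewrite (half_actC hS z Sf Se Sww Sww); lin_eq.
exists (t1 ^+ 2 * t2 ^+ 2), z; split => //.
  have tK (t : R) : `|t| <= K -> t ^+ 2 <= K ^+ 2.
    by move=> tK; rewrite -real_normK ?num_real // lerXn2r ?nnegrE.
  rewrite mulr_ge0 ?sqr_ge0 //= -[4%N]/(2 + 2)%N exprD.
  by apply: ler_pM; rewrite ?sqr_ge0 ?tK.
rewrite UE.
set q := half_act f w _ in zff *.
have -> : - half_act e w (half_act e w q) + (t1 ^+ 2 * t2 ^+ 2) *: z =
    - (half_act e w (half_act e w (q - t2 ^+ 2 *: z))
       + t2 ^+ 2 *: (half_act e w (half_act e w z) - t1 ^+ 2 *: z)).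
  by rewrite !half_actB !(half_actZ _ _ (t2 ^+ 2)); lin_eq.
rewrite normrN; apply: le_trans (ler_normD _ _) _.
have h1 : `|half_act e w (half_act e w (q - t2 ^+ 2 *: z))| <=
    K * (K * (2 * K * eps * `|z|)).
  apply: le_trans (Fn _) _; rewrite ler_wpM2l //.
  by apply: le_trans (Fn _) _; rewrite ler_wpM2l.
have h2 : `|t2 ^+ 2 *: (half_act e w (half_act e w z) - t1 ^+ 2 *: z)| <=
    K ^+ 2 * (2 * K * eps * `|z|).
  rewrite (normrZ (t2 ^+ 2)) normrX; apply: ler_pM => //; first exact: exprn_ge0.
  by rewrite lerXn2r ?nnegrE.
apply: le_trans (lerD h1 h2) _; rewrite le_eqVlt; apply/orP; left.
by apply/eqP; ring.
Qed.

(** Each [-t <= 0] is outside the spectrum, so [U_x + t] is bounded below by some [d]; the bound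
    [d / 2] survives for nearby [t], and compactness of [[0, B]] makes it uniform. *)
Lemma spectral_gap x (B : R) : positive_operator (Uop x) ->
  exists2 d, 0 < d & forall t y, 0 <= t <= B -> d * `|y| <= `|Uop x y + t *: y|.
Proof.
move=> pos.
have below t : 0 <= t -> exists2 d, 0 < d & forall y, d * `|y| <= `|Uop x y + t *: y|.
  move=> t0; have : ~ spectrum (Uop x) (- t).
    by move/pos => /=; rewrite oppr_gt0 ltNge t0.
  move=> /contrapT /invertible_bounded_below[d d0 dP]; exists d => // y.
  by have := dP y; rewrite scaleNr opprK.
have cpt : near_covering `[0, B] by apply/compact_near_coveringP; exact: segment_compact.
have [|d [d0 dP]] := @filter_ex _ (0 : R)^'+ _
    (fun d => 0 < d /\ `[0, B] `<=` [set t | forall y, d * `|y| <= `|Uop x y + t *: y|]).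
  apply: filterI; first exact: nbhs_right_gt.
  apply: (cpt R (0 : R)^'+ (fun d t => forall y, d * `|y| <= `|Uop x y + t *: y|)).
  move=> t; rewrite /= in_itv /= => /andP[t0 _].
  have [d d0 dP] := below t t0.
  have d2 : 0 < d / 2 by rewrite divr_gt0.
  near=> t' r => y.
  have tt' : `|t - t'| <= d / 2 by near: t'; apply: (@cvgr_dist_le _ _ _ _ _ id) d2; exact: cvg_id.
  have rd : r <= d / 2 by near: r; exact: nbhs_right_le.
  have := dP y.
  have -> : Uop x y + t *: y = (Uop x y + t' *: y) + (t - t') *: y by lin_eq.
  move=> h; have := le_trans h (ler_normD _ _); rewrite normrZ => h'.
  have h1 : `|t - t'| * `|y| <= d / 2 * `|y| by rewrite ler_wpM2r.
  have h2 : r * `|y| <= d / 2 * `|y| by rewrite ler_wpM2r.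
  rewrite -(lerD2r (`|t - t'| * `|y|)); apply: le_trans h'.
  by apply: le_trans (lerD h2 h1) _; rewrite -mulrDl -splitr.
exists d => // t y tB; apply: dP; by rewrite /= in_itv.
Unshelve. all: by end_near.
Qed.

Lemma positive_kernel S s w :
    closed_assoc S -> S s -> S w -> s ** s = \1 ->
    positive_operator (Uop (Uop w s)) ->
  forall y, s ** y = 0 -> y = 0.
Proof.
move=> hS Ss Sw s2 pos y sy; apply/eqP; apply: contraT => y0.
pose K := 2 * `|w| + 1.
have K0 : 0 < K by rewrite ltr_wpDl // mulr_ge0.
have [d d0 dP] := spectral_gap (K ^+ 4) pos.
(* This precision turns the error [4 K^3 eps] into [d / 2], below the gap [d]. *)
have eps0 : 0 < d / (8 * K ^+ 3) by rewrite divr_gt0 // mulr_gt0 // exprn_gt0.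
have [t [z [tK z0 zt]]] := kernel_approximate_eigenvector hS Ss Sw s2
  (ex_intro2 _ _ y sy y0) eps0.
have := le_trans (dP t z tK) zt; rewrite leNgt => /negP[].
rewrite ltr_pM2r ?normr_gt0 //.
have -> : 4 * (2 * `|w| + 1) ^+ 3 * (d / (8 * K ^+ 3)) = d / 2.
  by rewrite -/K; field; rewrite gt_eqF.
by rewrite ltr_pdivrMr // ltr_pMr // ltr1n.
Qed.

End SpectralGap.

Theorem corollary3p47 (R : realType) (V : jbAlgType R) (x : V)
    (x_inv : invertible x) :
  jordan_isomorphic (isotope_mul x) (@jmul R V) <-> positive_operator (Uop x).
Proof.
have [S [s [w [v [hS [Ss Sw Sv] s2 wv xE]]]]] := polar_decomposition x_inv.
rewrite xE in x_inv *; split=> [iso|pos].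
  apply: (central_symmetry_positive hS Ss Sw Sv) => // y.
  exact: (isotope_iso_kernel hS Sw Sv s2 wv iso).
apply: (central_symmetry_isotope hS Ss Sw Sv) => //.
exact: (positive_kernel hS Ss Sw s2 pos).
Qed.
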